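(* There is an absolute constant $c>0$ such that for all integers $n\ge 2$, $$C_{KL}(n)\le c\,\log n\cdot C_\eta(n).$$
   Context: An $n$-dimensional lattice $\mathcal L\subset\mathbb R^n$ is the set of integer linear combinations of $n$ linearly independent vectors of $\mathbb R^n$. For a lattice with basis matrix $B$ (possibly of lower rank), $\det=\sqrt{\det(B^{\mathsf T}B)}$. The dual lattice is $\mathcal L^*=\{y\in\mathrm{span}(\mathcal L):\langle y,x\rangle\in\mathbb Z\ \forall x\in\mathcal L\}$. A lattice subspace of $\mathcal L^*$ is a linear subspace $W$ that has a basis consisting of vectors of $\mathcal L^*$; then $\mathcal L^*\cap W$ is a lattice of rank $\dim W$. Smoothing parameter: $\eta(\mathcal L)$ is the unique $s>0$ with $\sum_{y\in\mathcal L^*}e^{-\pi s^2\|y\|_2^2}=3/2$. Covering radius: $\mu(\mathcal L)=\inf\{r\ge0:\mathrm{span}(\mathcal L)\subseteq\mathcal L+rB_2^n\}$, with $B_2^n$ the closed Euclidean unit ball. $C_\eta(n)>0$ is the smallest number such that for every $n$-dimensional lattice $\mathcal L\subset\mathbb R^n$, $\eta(\mathcal L)\le C_\eta(n)\max_{W}\det(\mathcal L^*\cap W)^{-1/\dim W}$, the maximum over lattice subspaces $W\ne\{0\}$ of $\mathcal L^*$. $C_{KL}(n)>0$ is the smallest number such that for every $n$-dimensional lattice $\mathcal L\subset\mathbb R^n$, $\mu(\mathcal L)\le C_{KL}(n)\max_{W}\sqrt{d}\,\det(\mathcal L^*\cap W)^{-1/d}$, the maximum over lattice subspaces $W$ of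 $\mathcal L^*$ of dimension $d=\dim W$ with $1\le d\le n$. *)

(* Defs.v *)
From HB Require Import structures.
From mathcomp Require Import all_boot all_order all_algebra.
From mathcomp Require Import all_classical all_reals all_analysis.

Set Implicit Arguments.
Unset Strict Implicit.
Unset Printing Implicit Defensive.

Import Order.TTheory GRing.Theory Num.Theory.

Local Open Scope classical_set_scope.
Local Open Scope ring_scope.

(* Vectors of R^n are row vectors, so the vectors of a basis are the ROWS of  *)
(* its basis matrix, and the Gram matrix B^T B of the column convention reads *)
(* B *m B^T.                                                                  *)

Section Extrema.
Variable R : realType.

(* As with any definite description below, the default value 0 is only        *)
(* returned when the object described does not exist.                         *)
Definition maximum (A : set R) : R := xget 0 (A `&` ubound A).
Definition minimum (A : set R) : R := xget 0 (A `&` lbound A).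

End Extrema.

Section Euclidean.
Variables (R : realType) (n : nat).
Implicit Types x y : 'rV[R]_n.

Definition dot x y : R := \sum_(i < n) x 0 i * y 0 i.

(* The library norm `|x| on 'rV[R]_n is the sup norm. *)
Definition norm2 x : R := Num.sqrt (dot x x).

Definition closed_unit_ball2 : set 'rV[R]_n := [set x | norm2 x <= 1].

Definition linear_span (S : set 'rV[R]_n) : set 'rV[R]_n :=
  [set x | exists s : seq 'rV[R]_n, [set` s] `<=` S /\ x \in << s >>%VS].

End Euclidean.

Section Lattices.
Variables (R : realType) (n : nat).
Implicit Types (L : set 'rV[R]_n) (W : {vspace 'rV[R]_n}).

Definition lattice_basis k (B : 'M[R]_(k, n)) L : Prop :=
  row_free B /\
  L = [set x | exists z : 'rV[int]_k, x = map_mx intr z *m B].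

Definition is_lattice k L : Prop := exists B : 'M[R]_(k, n), lattice_basis B L.

(* The value does not depend on the basis. *)
Definition lattice_det L : R :=
  xget 0 [set d : R | exists k (B : 'M[R]_(k, n)),
                    lattice_basis B L /\ d = Num.sqrt (\det (B *m B^T))].

Definition dual_lattice L : set 'rV[R]_n :=
  [set y | linear_span L y /\ forall x, L x -> dot y x \is a Num.int].

Definition lattice_subspace L W : Prop :=
  exists s : seq 'rV[R]_n, basis_of W s /\ [set` s] `<=` L.

Definition smoothing_parameter L : R :=
  xget 0 [set s : R | 0 < s /\
    (\esum_(y in dual_lattice L) (expR (- pi * s ^+ 2 * norm2 y ^+ 2))%:E
     = (3 / 2)%:E)%E].

Definition covering_radius L : R :=
  inf [set r : R | 0 <= r /\
    linear_span L `<=` [set v + r *: u | v in L & u in @closed_unit_ball2 R n]].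

Definition max_smoothing L : R :=
  maximum [set m : R | exists W, [/\ lattice_subspace (dual_lattice L) W,
    W != 0%VS &
    m = lattice_det (dual_lattice L `&` [set` W]) `^ (- (\dim W)%:R^-1)]].

Definition max_covering L : R :=
  maximum [set m : R | exists W, [/\ lattice_subspace (dual_lattice L) W,
    (1 <= \dim W <= n)%N &
    m = Num.sqrt (\dim W)%:R *
        lattice_det (dual_lattice L `&` [set` W]) `^ (- (\dim W)%:R^-1)]].

End Lattices.

Section Constants.
Variables (R : realType) (n : nat).

Definition C_eta : R :=
  minimum [set C : R | 0 < C /\ forall L : set 'rV[R]_n, is_lattice n L ->
                     smoothing_parameter L <= C * max_smoothing L].

Definition C_KL : R :=
  minimum [set C : R | 0 < C /\ forall L : set 'rV[R]_n, is_lattice n L ->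
                     covering_radius L <= C * max_covering L].

End Constants.

(* Main.v *)
From HB Require Import structures.
From mathcomp Require Import all_boot all_order all_fingroup all_algebra.
From mathcomp Require Import complex ring lra zify.
From mathcomp Require Import all_classical all_reals all_analysis.
Require Import Defs.

Set Implicit Arguments.
Unset Strict Implicit.
Unset Printing Implicit Defensive.

Import Order.TTheory GRing.Theory Num.Theory numFieldNormedType.Exports.

Local Open Scope classical_set_scope.
Local Open Scope ring_scope.

(* Let C be a basis of the dual lattice.  Along the flag of successive densest
   sublattices (the Harder-Narasimhan filtration) one rescales orthogonal directions
   by the slopes h_1, ..., h_n so that every sublattice of the rescaled dual has
   determinant at least 1; the rescaled lattice then has smoothing parameter at most
   C_eta(n) =: s.  A smoothing bound yields an anisotropic covering bound: consider
   the lattice walk with independent centred binomial coordinates of parameter M of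
   the order of s^2.  If no point of the coset were at weighted squared distance less
   than 6 M \sum w_i, the weighted slack 6 M \sum w_i - \sum w_i a_i^2 would be
   nonpositive on the coset; but finite Fourier inversion writes its mean on the
   coset as a positive main term plus an error controlled by the Gaussian mass of the
   nonzero dual vectors.  With w_i = h_i^2 this gives mu(L)^2 <= c s^2 \sum h_j^2.
   Finally h_j is at most the density of a sublattice of rank at least j, so
   h_j <= m / sqrt j, where m is the maximum in the definition of C_KL, and
   \sum h_j^2 is bounded by m^2 times a harmonic sum.
   Maxima over lattice subspaces exist because integral Pluecker coordinates of
   sublattices of bounded determinant are bounded; C_eta(n) is positive and attained
   because of a uniform packing bound on theta series. *)

(** * Gram determinants *)

(** The obstacle is a mismatch of coordinates: stability, and with it the smoothing bound, holds
    after the rescaling, whereas the covering radius is measured before it. The covering bound is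
    therefore proved for every positive diagonal weight with one and the same constant: the weights
    [h_i ^ 2] undo the rescaling exactly, and only their sum is paid for. A binomial walk is used
    because it has finite support and its transform is a product of even powers of cosines. Poisson
    summation then becomes a finite sum over the characters of a finite quotient of Z^n; the price
    is a passage to integral lattices. The constants fit for the following reason. A coordinate of
    the walk has variance M / 2, so the slack of the unrestricted walk has mean 11/2 M \sum w_i. At
    the other frequencies its transform is at most 10 M \sum w_i times a Gaussian. The nonzero dual
    vectors have Gaussian mass at most 1/2, which is 3/2 minus the contribution 1 of the origin, and
    5 < 11/2. *)

Notation gram X := (X *m X^T).
Notation intmx R K := (map_mx (intr : int -> R) K).

Section PosDef.
Variable R : rcfType.

Definition sqn n (x : 'rV[R]_n) : R := \sum_(i < n) x 0 i ^+ 2.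

Lemma sqnE n (x : 'rV[R]_n) : sqn x = (gram x) 0 0.
Proof. by rewrite mxE; apply: eq_bigr => i _; rewrite mxE expr2. Qed.

Lemma sqn_ge0 n (x : 'rV[R]_n) : 0 <= sqn x.
Proof. by apply: sumr_ge0 => i _; rewrite sqr_ge0. Qed.

Lemma sqn_eq0 n (x : 'rV[R]_n) : (sqn x == 0) = (x == 0).
Proof.
rewrite psumr_eq0 => [|i _]; last exact: sqr_ge0.
apply/idP/eqP => [/allP h|->]; last by apply/allP => i _; rewrite mxE expr0n /= eqxx.
apply/rowP => i; apply/eqP; rewrite mxE -sqrf_eq0.
exact: h (mem_index_enum i).
Qed.

Lemma sqn_gt0 n (x : 'rV[R]_n) : x != 0 -> 0 < sqn x.
Proof. by move=> x0; rewrite lt_def sqn_eq0 x0 sqn_ge0. Qed.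

Definition posdef n (G : 'M[R]_n) : Prop :=
  G^T = G /\ forall w : 'rV[R]_n, w != 0 -> 0 < (w *m G *m w^T) 0 0.

Lemma posdef_unit n (G : 'M[R]_n) : posdef G -> G \in unitmx.
Proof.
move=> [_ pG]; rewrite -row_free_unit -kermx_eq0.
apply/eqP/row_matrixP => i; rewrite row0.
apply/eqP; apply/negPn/negP => /pG.
suff -> : row i (kermx G) *m G = 0 by rewrite mul0mx mxE ltxx.
by apply/sub_kermxP; exact: row_sub.
Qed.

Lemma posdef_congr n (G T : 'M[R]_n) :
  posdef G -> T \in unitmx -> posdef (T *m G *m T^T).
Proof.
move=> [sG pG] uT; split=> [|w w0]; first by rewrite !trmx_mul trmxK sG mulmxA.
have -> : w *m (T *m G *m T^T) *m w^T = (w *m T) *m G *m (w *m T)^T.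
  by rewrite trmx_mul !mulmxA.
apply: pG; apply: contra w0 => /eqP w0.
by rewrite -(mulmxK uT w) w0 mul0mx.
Qed.

Lemma posdef_dr n1 n2 (G : 'M[R]_n1) (S : 'M[R]_n2) :
  posdef (block_mx G 0 0 S) -> posdef S.
Proof.
move=> [sG pG]; split; first by move: sG; rewrite tr_block_mx => /eq_block_mx[].
move=> w w0; have := pG (row_mx 0 w).
rewrite tr_row_mx mul_row_block !(mulmx0, mul0mx, add0r, trmx0).
rewrite mul_row_col mul0mx add0r; apply.
by apply: contra w0 => /eqP; rewrite -(row_mx0 _ _ n1 n2) => /eq_row_mx[_ ->].
Qed.

Lemma posdef_ulsub n1 n2 (G : 'M[R]_(n1 + n2)) : posdef G -> posdef (ulsubmx G).
Proof.
move=> [sG pG]; split; first by rewrite -[X in _ = ulsubmx X]sG trmx_ulsub.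
move=> w w0; have := pG (row_mx w 0).
rewrite -[in w *m _](submxK G) !(block_mxKul) -{1}(submxK G).
rewrite tr_row_mx mul_row_block !(mulmx0, mul0mx, addr0, trmx0).
rewrite mul_row_col mulmx0 addr0; apply.
by apply: contra w0 => /eqP; rewrite -(row_mx0 _ _ n1 n2) => /eq_row_mx[->].
Qed.

Lemma schur_diag n1 n2 (A : 'M[R]_n1) (B : 'M[R]_(n2, n1)) (D : 'M[R]_n2)
    (E := B *m invmx A) :
  A^T = A -> A \in unitmx ->
  block_mx 1%:M 0 (- E) 1%:M *m block_mx A B^T B D *m (block_mx 1%:M 0 (- E) 1%:M)^T
  = block_mx A 0 0 (D - E *m B^T).
Proof.
move=> sA uA; rewrite tr_block_mx !mulmx_block !trmx1 trmx0.
rewrite !(mul1mx, mulmx1, mul0mx, mulmx0, addr0, add0r).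
have h : - E *m A + B = 0 by rewrite /E mulNmx mulmxKV // addNr.
rewrite h mul0mx add0r.
have -> : A *m (- E)^T + B^T = 0.
  by rewrite -{1}sA -trmx_mul -linearD /= h trmx0.
by rewrite addrC mulNmx.
Qed.

Lemma unit_lunip n1 n2 (E : 'M[R]_(n2, n1)) : block_mx 1%:M 0 E 1%:M \in unitmx.
Proof. by rewrite unitmxE det_lblock !det1 mulr1 unitr1. Qed.

Lemma cholesky n (G : 'M[R]_n) : posdef G ->
  exists2 M : 'M[R]_n, M \in unitmx & G = gram M.
Proof.
elim: n G => [|n IHn] G pG.
  by exists 1%:M; [exact: unitmx1 | rewrite [LHS]flatmx0 [RHS]flatmx0].
rewrite -[n.+1]/(1 + n)%N in G pG *.
have pA := posdef_ulsub pG; have uA := posdef_unit pA.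
have sA := pA.1; have sG := pG.1.
set A := ulsubmx G in pA uA sA; set B := dlsubmx G; set D := drsubmx G.
have GE : G = block_mx A B^T B D.
  by rewrite -{1}(submxK G) /B trmx_dlsub sG.
have := schur_diag B D sA uA; set E := B *m _; set T := block_mx _ _ _ _.
rewrite -GE => TG.
have uT : T \in unitmx by exact: unit_lunip.
have pTG := posdef_congr pG uT; rewrite TG in pTG.
have [M2 uM2 SE] := IHn _ (posdef_dr pTG).
pose a := A 0 0.
have a0 : 0 < a.
  have := pA.2 1%:M; rewrite trmx1 mulmx1 mul1mx; apply.
  by apply/eqP => /matrixP/(_ 0 0)/eqP; rewrite !mxE oner_eq0.
pose M1 : 'M[R]_1 := (Num.sqrt a)%:M.
have AE : A = gram M1.
  by rewrite [A]mx11_scalar /M1 tr_scalar_mx -scalar_mxM -expr2 sqr_sqrtr // ltW.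
have uM1 : M1 \in unitmx.
  by rewrite unitmxE det_scalar1 unitfE sqrtr_eq0 -ltNge.
exists (invmx T *m block_mx M1 0 0 M2).
  by rewrite unitmx_mul unitmx_inv uT unitmxE det_lblock unitrM -!unitmxE uM1 uM2.
rewrite trmx_mul tr_block_mx !trmx0 mulmxA -[_ *m _ *m block_mx _ _ _ _]mulmxA mulmx_block.
rewrite !(mulmx0, mul0mx, addr0, add0r) -AE -SE -TG.
by rewrite trmx_inv !mulmxA mulVmx // mul1mx mulmxK // unitmx_tr.
Qed.

Lemma posdef_det n (G : 'M[R]_n) : posdef G -> 0 < \det G.
Proof.
move=> /cholesky[M uM ->]; rewrite det_mulmx det_tr -expr2 exprn_even_gt0 //=.
by move: uM; rewrite unitmxE unitfE.
Qed.

Lemma posdef_gram r n (X : 'M[R]_(r, n)) : row_free X -> posdef (gram X).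
Proof.
move=> fX; split=> [|w w0]; first by rewrite trmx_mul trmxK.
have -> : w *m gram X *m w^T = gram (w *m X) by rewrite trmx_mul !mulmxA.
rewrite -sqnE sqn_gt0 //; apply: contra w0 => /eqP.
by move/(congr1 (mulmxr (pinvmx X))) => /=; rewrite mulmxKp // mul0mx => ->.
Qed.

Lemma det_gram_gt0 r n (X : 'M[R]_(r, n)) : row_free X -> 0 < \det (gram X).
Proof. by move/posdef_gram/posdef_det. Qed.

(** The matrix determinant lemma, read off two triangular factorizations of one bordered matrix
    [F]. *)
Lemma det_add_rank1 n (B : 'M[R]_n) (v : 'rV[R]_n) : B \in unitmx ->
  \det (B + v^T *m v) = \det B * (1 + (v *m invmx B *m v^T) 0 0).
Proof.
move=> uB; pose F := block_mx 1%:M (- v) v^T B.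
have F1 : F = block_mx 1%:M 0 v^T 1%:M *m block_mx 1%:M (- v) 0 (B + v^T *m v).
  rewrite mulmx_block !(mul1mx, mulmx1, mul0mx, mulmx0, addr0, add0r).
  by rewrite mulmxN [B + _]addrC addKr.
have F2 : F = block_mx (1%:M + v *m invmx B *m v^T) (- (v *m invmx B)) 0 1%:M
              *m block_mx 1%:M 0 v^T B.
  rewrite mulmx_block !(mul1mx, mulmx1, mul0mx, mulmx0, addr0, add0r).
  by rewrite !mulNmx addrK mulmxKV.
have := congr1 determinant F1; rewrite {1}F2 !det_mulmx.
rewrite !(det_lblock, det_ublock) !det1 !(mul1r, mulr1) => <-.
by rewrite mulrC; congr (_ * _); rewrite [1%:M + _]mx11_scalar det_scalar1 !mxE.
Qed.

Lemma posdef_add_rank1 n (B : 'M[R]_n) (v : 'rV[R]_n) :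
  posdef B -> posdef (B + v^T *m v).
Proof.
move=> [sB pB]; split; first by rewrite linearD /= trmx_mul trmxK sB.
move=> w w0; rewrite mulmxDr mulmxDl mxE ltr_wpDr ?pB //.
have -> : w *m (v^T *m v) *m w^T = gram (w *m v^T).
  by rewrite trmx_mul trmxK !mulmxA.
by rewrite -sqnE sqn_ge0.
Qed.

Lemma det_add_rank1_ge n (B : 'M[R]_n) (v : 'rV[R]_n) :
  posdef B -> \det B <= \det (B + v^T *m v).
Proof.
move=> pB; have uB := posdef_unit pB.
rewrite det_add_rank1 // ler_peMr ?(ltW (posdef_det pB)) // lerDl.
have [M uM BE] := cholesky pB.
have -> : v *m invmx B *m v^T = gram (v *m invmx B *m M).
  rewrite trmx_mul -!mulmxA [M *m (_ *m _)]mulmxA -BE; congr (_ *m _).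
  by rewrite trmx_mul trmx_inv pB.1 mulKmx.
by rewrite -sqnE sqn_ge0.
Qed.

Lemma det_add_sum_rank1_ge n (B : 'M[R]_n) (I : Type) (s : seq I)
    (v : I -> 'rV[R]_n) : posdef B ->
  \det B <= \det (B + \sum_(i <- s) (v i)^T *m v i).
Proof.
move=> pB.
suff [] : posdef (B + \sum_(i <- s) (v i)^T *m v i) /\
          \det B <= \det (B + \sum_(i <- s) (v i)^T *m v i) by [].
elim: s => [|i s [IHp IH]]; first by rewrite big_nil addr0.
rewrite big_cons addrCA [_ + (B + _)]addrC.
split; first exact: posdef_add_rank1.
exact: le_trans IH (det_add_rank1_ge _ IHp).
Qed.

Lemma gram_sum_col r n (X : 'M[R]_(r, n)) :
  gram X = \sum_(j < n) (col j X)^T^T *m (col j X)^T.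
Proof.
apply/matrixP => i k; rewrite mxE summxE; apply: eq_bigr => j _.
by rewrite trmxK [RHS]mxE big_ord1 !mxE.
Qed.

Lemma det_add_gram_ge n m (B : 'M[R]_n) (N : 'M[R]_(n, m)) :
  posdef B -> \det B <= \det (B + gram N).
Proof. by move=> pB; rewrite (gram_sum_col N); apply: det_add_sum_rank1_ge. Qed.

(** The Gram matrix is the sum of the rank-one matrices of all columns, and dropping the columns
    outside the image of [f] can only lower the determinant. This is what bounds Pluecker
    coordinates by the determinant of a sublattice. *)
Lemma det_colsub_le r n (X : 'M[R]_(r, n)) (f : 'I_r -> 'I_n) : row_free X ->
  \det (colsub f X) ^+ 2 <= \det (gram X).
Proof.
move=> fX; have [->|d0] := eqVneq (\det (colsub f X)) 0.
  by rewrite expr0n /= ltW // det_gram_gt0.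
have uS : colsub f X \in unitmx by rewrite unitmxE unitfE.
have injf : injective f.
  move=> i j eqf; apply/eqP/negPn/negP => ij; case/negP: d0.
  rewrite -det_tr; apply/eqP/(determinant_alternate ij) => k.
  by rewrite !mxE eqf.
have -> : gram X = gram (colsub f X) +
    \sum_(j <- enum [predC codom f]) (col j X)^T^T *m (col j X)^T.
  rewrite gram_sum_col (bigID (mem (codom f))) /=; congr (_ + _).
    rewrite gram_sum_col -big_uniq /=; last by rewrite map_inj_uniq ?enum_uniq.
    rewrite big_image /=; apply: eq_bigr => i _.
    by rewrite !trmxK; congr (_ *m _); apply/matrixP => k l; rewrite !mxE.
  by rewrite big_enum.
rewrite expr2 -{2}det_tr -det_mulmx; apply: det_add_sum_rank1_ge.
by apply: posdef_gram; rewrite row_free_unit.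
Qed.
End PosDef.

(** * Integer matrices *)

Section IntMatrices.
Variable R : rcfType.

Lemma intmx_unit n (P : 'M[int]_n) : P \in unitmx -> intmx R P \in unitmx.
Proof.
by rewrite !unitmxE det_map_mx => uP; apply: rmorph_unit.
Qed.

Lemma det_int_unit_sqr n (P : 'M[int]_n) :
  P \in unitmx -> \det (intmx R P) ^+ 2 = 1.
Proof.
rewrite unitmxE det_map_mx -rmorphXn /= => uP.
have /orP[/eqP->|/eqP->] : (\det P == 1) || (\det P == -1) by [].
  by rewrite expr1n.
by rewrite sqrrN expr1n.
Qed.

Lemma gram_mul m r n (Q : 'M[R]_(m, r)) (X : 'M[R]_(r, n)) :
  gram (Q *m X) = Q *m gram X *m Q^T.
Proof. by rewrite trmx_mul !mulmxA. Qed.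

Lemma det_gram_mul r n (Q : 'M[R]_r) (X : 'M[R]_(r, n)) :
  \det (gram (Q *m X)) = \det Q ^+ 2 * \det (gram X).
Proof. by rewrite gram_mul !det_mulmx det_tr mulrAC expr2. Qed.

Lemma row_free_mul_unit r n (X : 'M[R]_(r, n)) (C : 'M[R]_n) :
  C \in unitmx -> row_free (X *m C) = row_free X.
Proof. by move=> uC; rewrite /row_free mxrankMfree // row_free_unit. Qed.

Lemma row_free_unit_mul r n (Q : 'M[R]_r) (X : 'M[R]_(r, n)) :
  Q \in unitmx -> row_free (Q *m X) = row_free X.
Proof. by move=> uQ; rewrite /row_free (eqmxMfull _ (_ : row_full Q)) // row_full_unit. Qed.

(** Block elimination subtracts from [Y] its orthogonal projection on the row space of [X]; the two
    row blocks then become orthogonal. *)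
Lemma block_reduce g f p q (Y : 'M[R]_(g, p)) (Z : 'M[R]_(g, q)) (X : 'M[R]_(f, p)) :
  row_free X -> exists Y' : 'M[R]_(g, p),
    \det (gram (block_mx Y Z X 0)) = \det (gram X) * \det (gram Y' + gram Z).
Proof.
move=> fX; have uG := posdef_unit (posdef_gram fX).
pose E := Y *m X^T *m invmx (gram X).
exists (Y - E *m X).
pose T : 'M[R]_(g + f) := block_mx 1%:M (- E) 0 1%:M.
have -> : \det (gram (block_mx Y Z X 0)) = \det (gram (T *m block_mx Y Z X 0)).
  by rewrite det_gram_mul det_ublock !det1 mulr1 expr1n mul1r.
rewrite mulmx_block !(mul1mx, mul0mx, mulmx0, addr0, add0r) mulNmx.
rewrite tr_block_mx mulmx_block trmx0 !(mul0mx, mulmx0, addr0).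
have h : (Y - E *m X) *m X^T = 0.
  by rewrite mulmxBl -mulmxA mulmxKV // subrr.
have h' : X *m (Y - E *m X)^T = 0.
  by rewrite -[X in X *m _]trmxK -trmx_mul h trmx0.
by rewrite h h' det_lblock mulrC.
Qed.

(** In the filtration, [X] is the part of a sublattice inside the first piece and [Z] its projection
    on the orthogonal complement; the remaining term [gram Y'] only raises the determinant. *)
Lemma det_gram_block_ge g f p q (Y : 'M[R]_(g, p)) (Z : 'M[R]_(g, q)) (X : 'M[R]_(f, p)) :
  row_free X -> row_free Z ->
  \det (gram X) * \det (gram Z) <= \det (gram (block_mx Y Z X 0)).
Proof.
move=> fX fZ; have [Y' ->] := block_reduce Y Z fX.
rewrite ler_wpM2l ?(ltW (det_gram_gt0 fX)) // addrC.
exact/det_add_gram_ge/posdef_gram.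
Qed.

Lemma det_gram_lblock p g q (X : 'M[R]_p) (Y : 'M[R]_(g, p)) (Z : 'M[R]_(g, q)) :
  X \in unitmx ->
  \det (gram (block_mx X 0 Y Z)) = \det (gram X) * \det (gram Z).
Proof.
move=> uX; pose E := Y *m invmx X.
pose T : 'M[R]_(p + g) := block_mx 1%:M 0 (- E) 1%:M.
have -> : \det (gram (block_mx X 0 Y Z)) = \det (gram (T *m block_mx X 0 Y Z)).
  by rewrite det_gram_mul det_lblock !det1 mulr1 expr1n mul1r.
rewrite mulmx_block !(mul1mx, mul0mx, mulmx0, addr0, add0r) mulNmx mulmxKV // addNr.
rewrite tr_block_mx mulmx_block !trmx0 !(mul0mx, mulmx0, addr0, add0r).
by rewrite det_lblock.
Qed.

(** Two factorizations of one Gram matrix differ by a rotation: the block Cholesky factor [F]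
    satisfies [gram F = gram C], so [invmx C *m F] is orthogonal. *)
Lemma block_triangularize d e (C : 'M[R]_(d + e)) : C \in unitmx ->
  exists U X Y Z, [/\ gram U = 1%:M, X \in unitmx, Z \in unitmx &
    C *m U = block_mx X 0 Y Z].
Proof.
move=> uC; have pG : posdef (gram C) by apply: posdef_gram; rewrite row_free_unit.
have pA := posdef_ulsub pG; have uA := posdef_unit pA.
have sA := pA.1; have sG := pG.1.
set A := ulsubmx (gram C) in pA uA sA; set B := dlsubmx (gram C); set D := drsubmx (gram C).
have GE : gram C = block_mx A B^T B D.
  by rewrite -{1}(submxK (gram C)) /B trmx_dlsub sG.
have := schur_diag B D sA uA; set E := B *m _; set T := block_mx _ _ _ _.
rewrite -GE => TG.
have uT : T \in unitmx by exact: unit_lunip.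
have pTG := posdef_congr pG uT; rewrite TG in pTG.
have [M2 uM2 SE] := cholesky (posdef_dr pTG).
have [M1 uM1 AE] := cholesky pA.
pose F := block_mx M1 0 (E *m M1) M2.
have FE : T *m F = block_mx M1 0 0 M2.
  rewrite mulmx_block !(mul1mx, mul0mx, mulmx0, addr0, add0r).
  by rewrite mulNmx addNr.
exists (invmx C *m F), M1, (E *m M1), M2; split=> //; last by rewrite mulKVmx.
rewrite gram_mul.
have -> : gram F = gram C.
  apply: (can_inj (mulKmx uT)); apply: (can_inj (mulmxK (_ : T^T \in unitmx))).
    by rewrite unitmx_tr.
  rewrite TG -gram_mul FE tr_block_mx mulmx_block !trmx0.
  by rewrite !(mul0mx, mulmx0, addr0, add0r) AE SE.
by rewrite mulmxA mulVmx // mul1mx trmx_inv mulmxV // unitmx_tr.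
Qed.

(** Divisibility pushes the zero invariant factors to the end, so the nonzero ones form an initial
    segment, whose length [k] is the rank. *)
Lemma smith_diag (r e : nat) (K : 'M[int]_(r, e)) :
  exists (L : 'M[int]_r) (Q : 'M[int]_e) (d : nat -> int) (k : nat),
   [/\ L \in unitmx, Q \in unitmx,
     (forall i, (i < k)%N = ((i < minn r e)%N && (d i != 0))) &
     K = L *m (\matrix_(i, j) (d i *+ (i == j :> nat))) *m Q].
Proof.
have [L uL [Q uQ [d sd ->]]] := int_Smith_normal_form K.
pose k := find (fun i => d`_i == 0) (iota 0 (minn r e)).
exists L, Q, (fun i => d`_i), k; split=> // i.
have km : (k <= minn r e)%N by rewrite -[minn r e](size_iota 0) find_size.
apply/idP/andP => [ik|[im di]].
  have im := leq_trans ik km; split => //.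
  by have := before_find 0%N ik; rewrite nth_iota // => ->.
rewrite ltnNge; apply: contra di => ki.
have hk : has (fun i => d`_i == 0) (iota 0 (minn r e)).
  by rewrite has_find size_iota (leq_ltn_trans ki).
have dk : d`_k == 0.
  by have := nth_find 0%N hk; rewrite nth_iota //= (leq_ltn_trans ki im).
have [sdi|lti] := leqP (size d) i; first by rewrite nth_default.
rewrite -dvd0z -[X in (X %| _)%Z](eqP dk).
apply: (sorted_leq_nth (@dvdz_trans) (@dvdzz) 0 sd) => //.
by rewrite inE (leq_ltn_trans ki).
Qed.

Lemma row_free_det (n : nat) (T : 'M[R]_n) : row_free T = (\det T != 0).
Proof. by rewrite row_free_unit unitmxE unitfE. Qed.

Lemma row_free_mull r m n (T : 'M[R]_(r, m)) (X : 'M[R]_(m, n)) :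
  row_free (T *m X) -> row_free T.
Proof.
rewrite /row_free !eqn_leq !rank_leq_row /= => h.
exact: leq_trans h (mxrankM_maxl _ _).
Qed.

Lemma row_free_usubmx d e (P : 'M[R]_(d + e)) : P \in unitmx -> row_free (usubmx P).
Proof.
move=> uP; have -> : usubmx P = row_mx 1%:M 0 *m P.
  by rewrite -{2}(vsubmxK P) mul_row_col mul1mx mul0mx addr0.
by rewrite row_free_mul_unit // /row_free rank_row_mx0 mxrank1.
Qed.

(** The top rows of [P] generate the saturation of the row lattice of [K], that is, all integer
    vectors in its span, because the other rows of [P] complete them to a basis of Z^n. The index is
    the absolute value of [\det T]. *)
Lemma primitive_factor d e (K : 'M[int]_(d, d + e)) : row_free (intmx R K) ->
  exists (P : 'M[int]_(d + e)) (T : 'M[int]_d),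
    [/\ P \in unitmx, \det T != 0 & K = T *m usubmx P].
Proof.
move=> fK; have [L [Q [c [k [uL uQ _ KE]]]]] := smith_diag K.
pose D : 'M[int]_d := \matrix_(i, j) (c i *+ (i == j :> nat)).
have KE' : K = (L *m D) *m usubmx Q.
  rewrite KE -!mulmxA; congr (_ *m _).
  have -> : \matrix_(i < d, j < d + e) (c i *+ (i == j :> nat)) = row_mx D 0.
    apply/matrixP => i j; rewrite -(fintype.splitK j).
    case: (fintype.split j) => a /=; rewrite ?(row_mxEl, row_mxEr) !mxE //=.
    case: eqP => // ia.
    by have := ltn_ord i; rewrite ia ltnNge leq_addr.
  by rewrite -{1}(vsubmxK Q) mul_row_col mul0mx addr0.
exists Q, (L *m D); split=> //.
rewrite -(intr_eq0 R) -det_map_mx -row_free_det.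
by move: fK; rewrite KE' map_mxM; exact: row_free_mull.
Qed.

Lemma int_row_reduce r e (K : 'M[int]_(r, e)) :
  exists g f (er : (g + f)%N = r) (P : 'M[int]_r) (K2 : 'M[int]_(g, e)),
    [/\ P \in unitmx, row_free (intmx R K2) &
     P *m K = castmx (er, erefl) (col_mx K2 0)].
Proof.
have [L [Q [c [k [uL uQ ck KE]]]]] := smith_diag K.
have [kr ke] : (k <= r)%N /\ (k <= e)%N.
  suff : (k <= minn r e)%N by rewrite leq_min => /andP.
  rewrite leqNgt; apply/negP => km; have := ck (minn r e).
  by rewrite km ltnn.
have er := subnKC kr; have ee := subnKC ke.
move: (r - k)%N (e - k)%N er ee => f e' er ee; subst r e.
pose D : 'M[int]_k := \matrix_(i, j) (c i *+ (i == j :> nat)).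
exists k, f, erefl, (invmx L), (D *m usubmx Q); split; first by rewrite unitmx_inv.
  rewrite map_mxM; have uD : intmx R D \in unitmx.
    rewrite -row_free_unit row_free_det det_map_mx intr_eq0.
    have -> : D = diag_mx (\row_i c i).
      by apply/matrixP => i j; rewrite !mxE.
    rewrite det_diag; apply/prodf_neq0 => i _; rewrite mxE.
    by have := ck i; rewrite ltn_ord => /esym/andP[].
  rewrite row_free_unit_mul // map_usubmx; apply: row_free_usubmx.
  exact: intmx_unit.
rewrite castmx_id KE -mulmxA mulKmx //.
have -> : \matrix_(i < k + f, j < k + e') (c i *+ (i == j :> nat)) = block_mx D 0 0 0.
  apply/matrixP => i j; rewrite -(fintype.splitK i) -(fintype.splitK j).
  case: (fintype.split i) => a; case: (fintype.split j) => b /=; rewrite ?(block_mxEul, block_mxEur, block_mxEdl, block_mxEdr) !mxE //=.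
  - by case: eqP => // ab; have := ltn_ord a; rewrite ab ltnNge leq_addr.
  - by case: eqP => // ab; have := ltn_ord b; rewrite -ab ltnNge leq_addr.
  case: eqP => // /addnI ab.
  have := ck (k + a)%N; rewrite ltnNge leq_addr /= => /esym/negbT.
  rewrite negb_and negbK => /orP[|/eqP -> //].
  by rewrite leq_min !ltn_add2l ltn_ord ab ltn_ord.
rewrite -{1}(vsubmxK Q) mul_block_col !mul0mx !addr0.
by [].
Qed.

End IntMatrices.

(** * Sublattices of minimal determinant *)

Section Pluecker.
Variable R : comNzRingType.

Definition minor r n (K : 'M[R]_(r, n)) (f : {ffun 'I_r -> 'I_n}) : R :=
  \det (colsub f K).

Lemma det_mulmx_sum r n (A : 'M[R]_(r, n)) (B : 'M[R]_(n, r)) :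
  \det (A *m B) = \sum_(f : {ffun 'I_r -> 'I_n})
     (\prod_i A i (f i)) * \det (rowsub f B).
Proof.
rewrite /(\det _).
under eq_bigr do under eq_bigr do rewrite mxE.
under eq_bigr do rewrite bigA_distr_bigA /= mulr_sumr.
rewrite exchange_big /=; apply: eq_bigr => f _.
rewrite mulr_sumr; apply: eq_bigr => s _.
rewrite big_split /= mulrCA; congr (_ * (_ * _)).
by apply: eq_bigr => i _; rewrite mxE.
Qed.

Lemma det_mulmx_minor r n (A : 'M[R]_(r, n)) (B : 'M[R]_(n, r)) :
  \det (A *m B) = \sum_(f : {ffun 'I_r -> 'I_n})
     (\prod_i B (f i) i) * minor A f.
Proof.
rewrite -det_tr trmx_mul det_mulmx_sum; apply: eq_bigr => f _; congr (_ * _).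
  by apply: eq_bigr => i _; rewrite mxE.
by rewrite /minor -det_tr; congr (\det _); apply/matrixP => i j; rewrite !mxE.
Qed.

(** Cauchy-Binet summed over all maps instead of increasing ones: non-injective maps contribute 0,
    and every subset of r columns occurs r! times. *)
Lemma det_mulmx_minor2 r n (K : 'M[R]_(r, n)) (B : 'M[R]_(n, r)) :
  \det (K *m B) *+ r`! =
    \sum_(f : {ffun 'I_r -> 'I_n}) minor K f * \det (rowsub f B).
Proof.
rewrite -card_Sn -sumr_const.
transitivity (\sum_(s : {perm 'I_r}) \sum_(f : {ffun 'I_r -> 'I_n})
   (-1) ^+ s * (\prod_i K i (f (s i))) * \det (rowsub f B)).
  apply: eq_bigr => s _; rewrite det_mulmx_sum.
  rewrite (reindex (fun f : {ffun 'I_r -> 'I_n} => [ffun i => f (s i)])) /=.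
    apply: eq_bigr => f _.
    have -> : rowsub [ffun i => f (s i)] B = perm_mx s *m rowsub f B.
      by rewrite -row_permE; apply/matrixP => i j; rewrite !mxE ffunE.
    rewrite det_mulmx det_perm mulrCA mulrA; congr (_ * _ * _).
    by apply: eq_bigr => i _; rewrite ffunE.
  exists (fun f : {ffun 'I_r -> 'I_n} => [ffun i => f ((s^-1)%g i)]) => f _.
    by apply/ffunP => i; rewrite !ffunE permKV.
  by apply/ffunP => i; rewrite !ffunE permK.
rewrite exchange_big /=; apply: eq_bigr => f _.
rewrite -mulr_suml; congr (_ * _); apply: eq_bigr => s _; congr (_ * _).
by apply: eq_bigr => i _; rewrite mxE.
Qed.

(* K enters the right-hand side through its minors only, so lattices with equal
   Pluecker coordinates have equal determinant. *)
Lemma minor_det_gramG r n (K : 'M[R]_(r, n)) (G : 'M[R]_n) :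
  \det (K *m (G *m K^T)) *+ r`! =
    \sum_(f : {ffun 'I_r -> 'I_n}) minor K f *
      \sum_(g : {ffun 'I_r -> 'I_n}) (\prod_i G (f i) (g i)) * minor K g.
Proof.
rewrite det_mulmx_minor2; apply: eq_bigr => f _; congr (_ * _).
rewrite -mul_rowsub_mx det_mulmx_sum; apply: eq_bigr => g _; congr (_ * _).
  by apply: eq_bigr => i _; rewrite mxE.
by rewrite /minor -det_tr; congr (\det _); apply/matrixP => i j; rewrite !mxE.
Qed.

End Pluecker.

(* A function attains its minimum if each of its sublevel sets takes finitely many
   values; [code] witnesses the finiteness below the level of [x0]. *)
Lemma finite_code_min (R : realDomainType) (T : Type) (I : finType)
    (P : T -> Prop) (F : T -> R) (code : T -> I) (x0 : T) :
  P x0 ->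
  (forall x y, P x -> P y -> F x <= F x0 -> F y <= F x0 ->
     code x = code y -> F x = F y) ->
  exists2 x, P x & forall y, P y -> F x <= F y.
Proof.
move=> Px0 codeF.
pose Q i x := [/\ P x, F x <= F x0 & code x = i].
have Qx0 : Q (code x0) x0 by split.
pose pt i := if pselect (exists x, Q i x) is left h then projT1 (cid h) else x0.
have ptQ i x : Q i x -> Q i (pt i).
  by rewrite /pt => q; case: pselect => [h|[]]; [case: (cid h) | exists x].
pose b i := `[< exists x, Q i x >].
have b0 : b (code x0) by apply/asboolP; exists x0.
case: (arg_minP (fun i => F (pt i)) b0) => i /asboolP[x /ptQ[Pi Fi ci]] mini.
exists (pt i) => // y Py.
have [Fy|/ltW Fy] := leP (F y) (F x0); last exact: le_trans Fi Fy.
have qy : Q (code y) y by split.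
have [Pc Fc cc] := ptQ _ _ qy.
rewrite -(codeF _ _ Pc Py Fc Fy cc); apply: mini.
by apply/asboolP; exists y.
Qed.

Section Minimum.
Variable R : realType.

Lemma minor_intmx r n (K : 'M[int]_(r, n)) f :
  minor (intmx R K) f = (minor K f)%:~R.
Proof.
by rewrite /minor -det_map_mx; congr (\det _); apply/matrixP => i j; rewrite !mxE.
Qed.

Lemma minor_eq_det_gram r n (K K' : 'M[int]_(r, n)) (C : 'M[R]_n) :
  minor K =1 minor K' ->
  \det (gram (intmx R K *m C)) = \det (gram (intmx R K' *m C)).
Proof.
move=> eqK; apply: (pmulrnI (fact_gt0 r)).
rewrite !gram_mul -!mulmxA !(mulmxA C) !minor_det_gramG.
apply: eq_bigr => f _; rewrite !minor_intmx eqK; congr (_ * _).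
by apply: eq_bigr => g _; rewrite !minor_intmx eqK.
Qed.

(** A minor of [K] is a combination of minors of [K *m C] whose coefficients are products of entries
    of [invmx C], and each of those minors is bounded by [det_colsub_le]. *)
Lemma minor_bound r n (C : 'M[R]_n) : C \in unitmx ->
  exists2 b : R, 0 <= b & forall (K : 'M[int]_(r, n)) f, row_free (intmx R K) ->
    `|(minor K f)%:~R| <= b * Num.sqrt (\det (gram (intmx R K *m C))).
Proof.
move=> uC; pose h (f g : {ffun 'I_r -> 'I_n}) := \prod_i `|invmx C (g i) (f i)|.
have h0 f g : 0 <= h f g by apply: prodr_ge0.
exists (\sum_f \sum_g h f g) => [|K f fK].
  by apply: sumr_ge0 => f _; apply: sumr_ge0.
rewrite -minor_intmx /minor.
have -> : colsub f (intmx R K) = intmx R K *m C *m colsub f (invmx C).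
  by rewrite mulmx_colsub mulmxK.
rewrite det_mulmx_minor (le_trans (ler_norm_sum _ _ _)) // mulr_suml.
rewrite [leRHS](bigD1 f) //= ler_wpDr //.
  by apply: sumr_ge0 => f' _; rewrite mulr_ge0 ?sqrtr_ge0 // sumr_ge0.
rewrite mulr_suml; apply: ler_sum => g _; rewrite normrM.
rewrite normr_prod ler_pM ?prodr_ge0 //.
  by rewrite le_eqVlt; apply/orP; left; apply/eqP/eq_bigr => i _; rewrite mxE.
rewrite -sqrtr_sqr ler_sqrt ?det_gram_gt0 ?row_free_mul_unit //.
  by rewrite det_colsub_le // row_free_mul_unit.
by rewrite ltW // det_gram_gt0 // row_free_mul_unit.
Qed.

Lemma det_gram_min r n (C : 'M[R]_n) : C \in unitmx -> (r <= n)%N ->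
  exists2 K : 'M[int]_(r, n), row_free (intmx R K) &
   forall K' : 'M[int]_(r, n), row_free (intmx R K') ->
    \det (gram (intmx R K *m C)) <= \det (gram (intmx R K' *m C)).
Proof.
move=> uC rn; have [b b0 bP] := minor_bound r uC.
pose K0 : 'M[int]_(r, n) := pid_mx r.
have fK0 : row_free (intmx R K0) by rewrite map_pid_mx /row_free rank_pid_mx.
pose F (K : 'M[int]_(r, n)) := \det (gram (intmx R K *m C)).
have [m mP] : exists m : nat, forall K : 'M[int]_(r, n), row_free (intmx R K) ->
    F K <= F K0 -> forall f, (`|minor K f| <= m)%N.
  exists (Num.bound (b * Num.sqrt (F K0))) => K fK FK f.
  rewrite -(ler_nat R) natr_absz intr_norm.
  apply: (le_trans (bP _ f fK)); apply: (le_trans _ (ltW (archi_boundP _))).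
    by rewrite ler_wpM2l // ler_wsqrtr.
  by rewrite mulr_ge0 // sqrtr_ge0.
(* Below the level of [K0] the minors lie between -m and m, so after the shift by m they fit in the
   ordinal and [inord] loses nothing. *)
pose code (K : 'M[int]_(r, n)) : {ffun {ffun 'I_r -> 'I_n} -> 'I_(m + m).+1} :=
  [ffun f => inord (absz (minor K f + m%:Z))].
apply: (finite_code_min (F := F) (code := code) fK0) => K K' fK fK' FK FK' /ffunP eqc.
apply: minor_eq_det_gram => f; have := eqc f; rewrite !ffunE.
move/(congr1 val); have := mP _ fK FK f; have := mP _ fK' FK' f.
move: (minor K f) (minor K' f) => a a' h1 h2 /=; rewrite !inordK; lia.
Qed.

End Minimum.

(** * The canonical filtration *)

Section Scaling.
Variable R : realType.

Lemma row_free_leq r n (K : 'M[R]_(r, n)) : row_free K -> (r <= n)%N.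
Proof. by rewrite /row_free => /eqP <-; exact: rank_leq_col. Qed.

Lemma det_gram0 n (X : 'M[R]_(0, n)) : \det (gram X) = 1.
Proof. by rewrite det_mx00. Qed.

(** Only one minimizer per rank matters. Its logarithmic density is [- ln d / (2 r)], and the
    maximum over the ranks gives the least dilation under which no sublattice has Gram determinant
    below 1. *)
Lemma densest_sublattice n (C : 'M[R]_n) : C \in unitmx -> (0 < n)%N ->
  exists d (K : 'M[int]_(d, n)) (a : R),
   [/\ (0 < d)%N, row_free (intmx R K), 0 < a,
     a ^+ (2 * d) * \det (gram (intmx R K *m C)) = 1 &
     forall r (K' : 'M[int]_(r, n)), row_free (intmx R K') ->
       1 <= a ^+ (2 * r) * \det (gram (intmx R K' *m C))].
Proof.
move=> uC; case: n C uC => [//|n] C uC _.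
have /choice[d dP] (i : 'I_n.+1) : exists di : R,
    (exists2 K : 'M[int]_(i.+1, n.+1), row_free (intmx R K) &
       \det (gram (intmx R K *m C)) = di) /\
    (forall K : 'M[int]_(i.+1, n.+1), row_free (intmx R K) ->
       di <= \det (gram (intmx R K *m C))).
  have lei : (i.+1 <= n.+1)%N by [].
  have [K fK minK] := det_gram_min uC lei.
  by exists (\det (gram (intmx R K *m C))); split; [exists K | exact: minK].
have d0 i : 0 < d i.
  have [[K fK <-] _] := dP i.
  by apply: det_gram_gt0; rewrite row_free_mul_unit.
pose x i : R := - ln (d i) / (2 * i.+1)%:R.
have xE i : expR (x i) ^+ (2 * i.+1) * d i = 1.
  rewrite -expRM_natl -[X in _ * X]lnK ?posrE // -expRD.
  by rewrite mulrC divfK ?pnatr_eq0 // addNr expR0.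
have [i _ maxi] := arg_maxP x (erefl true : xpredT (ord0 : 'I_n.+1)).
have [[K fK dK] _] := dP i.
exists i.+1, K, (expR (x i)); split => //; [exact: expR_gt0 | by rewrite dK|].
move=> [|r] K' fK'; first by rewrite muln0 expr0 det_gram0 mulr1.
have rn : (r < n.+1)%N := row_free_leq fK'.
have [j er] : exists j : 'I_n.+1, r = j by exists (Ordinal rn).
subst r; rewrite -[X in X <= _](xE j) ler_pM ?exprn_ge0 ?expR_ge0 //.
- exact: ltW.
- by rewrite lerXn2r ?nnegrE ?expR_ge0 // ler_expR; apply: maxi.
- exact: (dP j).2 K' fK'.
Qed.

Lemma row_free_dsubmx g f p q (Y : 'M[R]_(g, p)) (Z : 'M[R]_(g, q)) (X : 'M[R]_(f, p)) :
  row_free (block_mx Y Z X 0) -> row_free X.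
Proof.
move=> fM; have : row_free (row_mx X (0 : 'M[R]_(f, q))).
  have -> : row_mx X 0 = row_mx 0 1%:M *m block_mx Y Z X 0.
    by rewrite mul_row_block !(mul0mx, mul1mx, add0r).
  by rewrite /row_free mxrankMfree // rank_row_0mx mxrank1.
by rewrite /row_free rank_row_mx0.
Qed.

Lemma gram_rot r n (X : 'M[R]_(r, n)) (U : 'M[R]_n) :
  gram U = 1%:M -> gram (X *m U) = gram X.
Proof. by move=> oU; rewrite gram_mul oU mulmx1. Qed.

Lemma gramZ r n (a : R) (X : 'M[R]_(r, n)) : gram (a *: X) = a ^+ 2 *: gram X.
Proof. by rewrite linearZ /= -scalemxAl -scalemxAr scalerA. Qed.

Lemma det_gramZ r n (a : R) (X : 'M[R]_(r, n)) :
  \det (gram (a *: X)) = a ^+ (2 * r) * \det (gram X).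
Proof. by rewrite gramZ detZ exprM. Qed.

Lemma unit_diag n (h : 'rV[R]_n) : (forall j, 0 < h 0 j) -> diag_mx h \in unitmx.
Proof.
move=> h0; rewrite unitmxE det_diag unitfE.
by apply/prodf_neq0 => i _; rewrite gt_eqF.
Qed.

Lemma gram_unit n (U : 'M[R]_n) : gram U = 1%:M -> U \in unitmx.
Proof. by case/mulmx1_unit. Qed.

(* The Harder-Narasimhan filtration: in the orthonormal basis U adapted to the flag
   of successive densest sublattices, scaling each graded piece by its density makes
   all sublattices have determinant at least 1. *)
Lemma stable_scaling n (C : 'M[R]_n) : C \in unitmx ->
  exists (U : 'M[R]_n) (h : 'rV[R]_n),
  [/\ gram U = 1%:M, forall j, 0 < h 0 j,
     forall r (K : 'M[int]_(r, n)), row_free (intmx R K) ->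
       1 <= \det (gram (intmx R K *m (C *m U *m diag_mx h))) &
     forall j : 'I_n, exists D (K : 'M[int]_(D, n)),
       [/\ (j < D)%N, row_free (intmx R K) &
           h 0 j ^+ (2 * D) * \det (gram (intmx R K *m C)) <= 1]].
Proof.
have [N] := ubnP n; elim: N n C => // N IHN n C nN uC.
have [n0|n_gt0] := posnP n.
  subst n; exists 1%:M, 0; split => [|[]//| |[]//].
    by rewrite trmx1 mulmx1.
  by move=> [|r] K fK; [rewrite det_gram0 | have := row_free_leq fK].
have [d [K [a [d0 fK a0 aK maxa]]]] := densest_sublattice uC n_gt0.
have [e en] : exists e, (d + e)%N = n.
  by exists (n - d)%N; apply/subnKC/(row_free_leq fK).
subst n.
have [P [T [uP T0 KE]]] := primitive_factor fK.
pose PR := intmx R P; have uPR : PR \in unitmx by exact: intmx_unit.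
have uPC : PR *m C \in unitmx by rewrite unitmx_mul uPR.
have [U1 [X [Y [Z [oU1 uX uZ CU1]]]]] := block_triangularize uPC.
have fuP : row_free (usubmx PR) := row_free_usubmx uPR.
have gX : gram X = gram (usubmx PR *m C).
  rewrite -(gram_rot (usubmx PR *m C) oU1).
  have -> : usubmx PR *m C *m U1 = row_mx X 0 by rewrite !mul_usub_mx CU1 /block_mx col_mxKu.
  by rewrite tr_row_mx mul_row_col trmx0 mulmx0 addr0.
(* Passing to the saturation divides the Gram determinant by [\det T ^+ 2 >= 1], while the
   maximality of [a] forbids a value below 1. *)
have detX : a ^+ (2 * d) * \det (gram X) = 1.
  apply/eqP; rewrite eq_le; apply/andP; split; last first.
    by rewrite gX -map_usubmx maxa // map_usubmx.
  have a_ge0 := ltW a0.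
  rewrite -[X in _ <= X]aK ler_wpM2l ?exprn_ge0 // KE map_mxM -[_ *m C]mulmxA det_gram_mul map_usubmx gX.
  have fuPC : row_free (usubmx PR *m C) by rewrite row_free_mul_unit.
  rewrite ler_peMl ?(ltW (det_gram_gt0 fuPC)) //.
  rewrite det_map_mx -rmorphXn /= ler1z.
  by rewrite -gtz0_ge1 exprn_even_gt0.
have [|U2 [h2 [oU2 h20 st2 fl2]]] := IHN e Z _ uZ.
  by move: nN d0; clear; lia.
have uU2 := gram_unit oU2.
pose h := row_mx (const_mx a) h2 : 'rV[R]_(d + e).
exists (U1 *m block_mx 1%:M 0 0 U2), h.
have h_gt0 j : 0 < h 0 j.
  by rewrite mxE; case: (fintype.split j) => k //; rewrite mxE.
split => //.
- rewrite gram_mul tr_block_mx mulmx_block !(trmx0, trmx1).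
  by rewrite !(mulmx0, mul0mx, addr0, add0r, mulmx1) oU2 -scalar_mx_block mulmx1.
- move=> r K' fK'.
  (* In coordinates adapted to the first piece, row reduction of the last coordinates splits the
     sublattice into a part [J3] inside that piece and a projection [K2] of full rank. *)
  pose J := K' *m invmx P.
  have JE : intmx R K' = intmx R J *m PR by rewrite -map_mxM /J mulmxKV.
  pose W := Z *m U2 *m diag_mx h2.
  have uW : W \in unitmx by rewrite !unitmx_mul uZ uU2 unit_diag.
  have ME : PR *m (C *m (U1 *m block_mx 1%:M 0 0 U2) *m diag_mx h) =
      block_mx (a *: X) 0 (a *: Y) W.
    rewrite !mulmxA CU1 mulmx_block !(mulmx0, mul0mx, addr0, add0r, mulmx1).
    rewrite diag_mx_row mulmx_block !(mulmx0, mul0mx, addr0, add0r, mulmx1).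
    by rewrite diag_const_mx !mul_mx_scalar.
  have -> : intmx R K' *m (C *m (U1 *m block_mx 1%:M 0 0 U2) *m diag_mx h) =
      intmx R J *m block_mx (a *: X) 0 (a *: Y) W by rewrite JE -mulmxA ME.
  have fJ : row_free (intmx R J) by move: fK'; rewrite JE row_free_mul_unit.
  have [g [f [er [Q [K2 [uQ fK2 QK]]]]]] := int_row_reduce R (rsubmx J).
  subst r; rewrite castmx_id in QK.
  pose J1 := usubmx (Q *m lsubmx J); pose J3 := dsubmx (Q *m lsubmx J).
  have QJ : Q *m J = block_mx J1 K2 J3 0.
    by rewrite -[J in Q *m J]hsubmxK mul_mx_row QK block_mxEh /J1 /J3 vsubmxK.
  rewrite -[X in _ <= X]mul1r -[X in _ <= X * _](det_int_unit_sqr R uQ).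
  rewrite -det_gram_mul [_ *m (_ *m block_mx _ _ _ _)]mulmxA -map_mxM QJ map_block_mx mulmx_block map_mx0.
  rewrite !(mulmx0, mul0mx, addr0, add0r).
  have fJ3 : row_free (intmx R J3).
    apply: (@row_free_dsubmx _ _ _ _ (intmx R J1) (intmx R K2)).
    by rewrite -(map_mx0 intr) -map_block_mx -QJ map_mxM row_free_unit_mul // intmx_unit.
  have uaX : a *: X \in unitmx by rewrite unitmxZ // unitfE gt_eqF.
  have fJ3X : row_free (intmx R J3 *m (a *: X)) by rewrite row_free_mul_unit.
  have fK2W : row_free (intmx R K2 *m W) by rewrite row_free_mul_unit.
  apply: le_trans (det_gram_block_ge _ fJ3X fK2W).
  rewrite -[X in X <= _]mulr1 ler_pM ?ler01 //; last exact: st2.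
  have fJ3P : row_free (intmx R (J3 *m usubmx P)).
    by rewrite map_mxM map_usubmx /row_free mxrankMfree.
  have gJ : gram (intmx R (J3 *m usubmx P) *m C) = gram (intmx R J3 *m X).
    by rewrite [RHS]gram_mul gX map_mxM map_usubmx -[_ *m C]mulmxA [LHS]gram_mul.
  by have := maxa _ _ fJ3P; rewrite gJ -scalemxAr det_gramZ.
move=> j; rewrite -(fintype.splitK j); case: (fintype.split j) => k /=.
  exists d, K; split => //.
  by rewrite row_mxEl mxE aK.
have [D [K' [kD fK' hK']]] := fl2 k.
(* The preimage of the sublattice [K'] of the quotient: it contains the whole first piece, whence
   its rank [d + D]. *)
pose K1 := block_mx 1%:M 0 0 K' *m P.
have fK1 : row_free (intmx R K1).
  rewrite map_mxM row_free_mul_unit // map_block_mx !map_mx0 map_mx1.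
  have [B K'B] := row_freeP fK'; apply/row_freeP; exists (block_mx 1%:M 0 0 B).
  rewrite mulmx_block !(mulmx0, mul0mx, addr0, add0r, mul1mx) K'B.
  by rewrite -scalar_mx_block.
have gK1 : \det (gram (intmx R K1 *m C)) = \det (gram X) * \det (gram (intmx R K' *m Z)).
  rewrite map_mxM -[_ *m C]mulmxA -(gram_rot _ oU1) -[_ *m _ *m U1]mulmxA CU1.
  rewrite map_block_mx !map_mx0 map_mx1 mulmx_block !(mulmx0, mul0mx, addr0, add0r, mul1mx).
  by rewrite det_gram_lblock.
exists (d + D)%N, K1; split=> //; first by rewrite ltn_add2l.
have := maxa _ _ fK1; rewrite gK1 row_mxEr.
have := det_gram_gt0 (_ : row_free X); rewrite row_free_unit => /(_ uX).
have := h20 k; move: hK' detX kD a0; clear.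
move: (h2 0 k) (\det (gram X)) (\det _) => b x g bg ax kD a0 b0 x0.
have expD (t : R) : t ^+ (2 * (d + D)) = t ^+ (2 * d) * t ^+ (2 * D).
  by rewrite mulnDr exprD.
rewrite !expD mulrACA ax mul1r => ag.
have g0 : 0 < g.
  by rewrite -(pmulr_rgt0 _ (exprn_gt0 (2 * D) a0)) (lt_le_trans ltr01 ag).
(* Later slopes are at most the first one: on the preimage, maximality of [a] leaves
   [a ^+ (2 * D) * g >= 1] once the factor of [X] is cancelled. *)
have ba : b <= a.
  rewrite -(@ler_pXn2r _ (2 * D)) ?nnegrE ?(ltW a0) ?(ltW b0) //; last by move: kD; lia.
  by rewrite -(ler_pM2r g0) (le_trans bg ag).
rewrite mulrACA -[X in _ <= X]mulr1 ler_pM // ?mulr_ge0 ?exprn_ge0 ?(ltW b0) ?(ltW x0) ?(ltW g0) //.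
by rewrite -[X in _ <= X]ax ler_wpM2r ?(ltW x0) // lerXn2r ?nnegrE ?(ltW a0) ?(ltW b0).
Qed.

End Scaling.

(** * Binomial random walks and their characters *)

Section Cis.
Variable R : realType.
Implicit Types t u : R.

Definition cis t : R[i] := (cos t +i* sin t)%C.

Lemma cisD t u : cis (t + u) = cis t * cis u.
Proof. by rewrite /cis cosD sinD; apply/eqP; rewrite eq_complex /= eqxx addrC eqxx. Qed.

Lemma cis0 : cis 0 = 1. Proof. by rewrite /cis cos0 sin0. Qed.

Lemma cis_sum (I : finType) (f : I -> R) : cis (\sum_i f i) = \prod_i cis (f i).
Proof. exact: (big_morph cis cisD cis0). Qed.

Lemma cis_natmul n t : cis (n%:R * t) = cis t ^+ n.
Proof.
elim: n => [|n IH]; first by rewrite mul0r cis0 expr0.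
by rewrite -addn1 natrD mulrDl mul1r cisD IH addn1 exprSr.
Qed.

Lemma cis_mulN t : cis t * cis (- t) = 1.
Proof. by rewrite -cisD subrr cis0. Qed.

Lemma cis2pi : cis (pi *+ 2) = 1.
Proof. by rewrite /cis cos2pi sin2pi. Qed.

Lemma cis2pi_int (m : int) : cis (m%:~R * (pi *+ 2)) = 1.
Proof.
case: m => m; first by rewrite -pmulrn cis_natmul cis2pi expr1n.
have h : cis (m.+1%:R * (pi *+ 2)) = 1 by rewrite cis_natmul cis2pi expr1n.
by rewrite NegzE mulrNz mulNr -[LHS]mul1r -{1}h cis_mulN.
Qed.

Lemma cis_eq1_eq0 t : 0 <= t -> t < pi *+ 2 -> cis t = 1 -> t = 0.
Proof.
move=> t0 t2 /(congr1 (@complex.Re R)) /= c1.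
apply/eqP; rewrite eq_le t0 andbT leNgt; apply/negP => tp.
have : 0 < sin (t / 2).
  by apply: sin_gt0_pi; rewrite divr_gt0 //= ltr_pdivrMr // mulr_natr.
rewrite lt_neqAle => /andP[/negP[]]; rewrite eq_sym -sqrf_eq0.
have := cos_mulr2n (t / 2); rewrite -[_ *+ 2]mulr_natr divfK // c1.
rewrite -mulr_natr sin2cos2 => h; apply/eqP; lra.
Qed.

Lemma cisDN t : cis (- t) + cis t = (2 * cos t)%:C%C.
Proof.
rewrite /cis cosN sinN; apply/eqP; rewrite eq_complex /=.
by rewrite addNr eqxx andbT mulrC mulr_natr mulr2n.
Qed.

Lemma cis_split M a t : (a <= 2 * M)%N ->
  cis ((a%:R - M%:R) * (t * 2)) = cis (- t) ^+ (2 * M - a) * cis t ^+ a.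
Proof.
move=> aM; rewrite -!cis_natmul -cisD natrB // natrM; congr cis; ring.
Qed.

Lemma binomial_cis M t :
  \sum_(a < (2 * M).+1) ('C(2 * M, a)%:R)%:C%C * cis ((a%:R - M%:R) * (t * 2)) =
  ((2 * cos t) ^+ (2 * M))%:C%C.
Proof.
rewrite rmorphXn /= -cisDN exprDn; apply: eq_bigr => a _.
rewrite cis_split; last by rewrite -ltnS.
by rewrite rmorph_nat mulr_natl.
Qed.

(** With 2M = m + 2, the weight a (2M - a) equals M^2 - (a - M)^2, and absorbing it into the
    binomial coefficient leaves one of order 2M - 2. The second moment of the walk is thus expressed
    by a walk with two steps fewer; [x * y = 1] accounts for the two lost powers. *)
Lemma binomial_moment (V : comNzRingType) m (x y : V) : x * y = 1 ->
  \sum_(a < m.+3) ('C(m.+2, a) * (a * (m.+2 - a)))%:R * (x ^+ (m.+2 - a) * y ^+ a) =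
  (m.+2 * m.+1)%:R * (x + y) ^+ m.
Proof.
move=> xy; rewrite big_ord_recl /= mul0n muln0 mul0r add0r.
rewrite big_ord_recr /= subnn !muln0 mul0r addr0.
rewrite exprDn mulr_sumr; apply: eq_bigr => b _ /=.
rewrite /bump /= add1n subSS.
have -> : ('C(m.+2, b.+1) * (b.+1 * (m.+1 - b)) = m.+2 * m.+1 * 'C(m, b))%N.
  rewrite mulnA [('C(_, _) * _)%N]mulnC -mul_bin_diag /=.
  by rewrite -!mulnA; congr (_ * _)%N; rewrite [RHS]mul_bin_down mulnC.
have bm : (b <= m)%N by rewrite -ltnS.
rewrite subSn // exprS exprS mulrACA xy mul1r natrM -mulrA; congr (_ * _).
by rewrite mulr_natl.
Qed.

Lemma binomial_cis_moment M t : (0 < M)%N ->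
  \sum_(a < (2 * M).+1) ('C(2 * M, a)%:R * (M%:R ^+ 2 - (a%:R - M%:R) ^+ 2))%:C%C *
     cis ((a%:R - M%:R) * (t * 2)) =
  ((2 * M * (2 * M).-1)%:R * (2 * cos t) ^+ (2 * M - 2))%:C%C.
Proof.
case: M => // M _.
have e2 : (2 * M.+1 = (2 * M).+2)%N by lia.
have -> : ((2 * M.+1).-1 = (2 * M).+1)%N by lia.
have -> : (2 * M.+1 - 2 = 2 * M)%N by lia.
rewrite rmorphM rmorphXn rmorph_nat /= -cisDN.
transitivity (\sum_(a < (2 * M.+1).+1) (('C(2 * M.+1, a) * (a * (2 * M.+1 - a)))%:R *
   (cis (- t) ^+ (2 * M.+1 - a) * cis t ^+ a))).
  apply: eq_bigr => a _; have aM : (a <= 2 * M.+1)%N by rewrite -ltnS.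
  rewrite cis_split // -(rmorph_nat (real_complex R)); congr (_ %:C%C * _).
  rewrite natrM; congr (_ * _); rewrite natrM natrB // natrM; ring.
rewrite e2 (binomial_moment (2 * M)); last by rewrite mulrC cis_mulN.
by [].
Qed.

(* [sin t = 2 cos v sin v] with [v = t / 2], and [sin v >= v cos v] by the mean
   value theorem, while [cos v ^+ 2 >= 1 / 2]. *)
Lemma sin_ge_half t : 0 <= t <= pi / 2 -> t / 2 <= sin t.
Proof.
move=> /andP[t0 tp].
have pi0 := @pi_gt0 R.
pose v := t / 2.
have v0 : 0 <= v by rewrite /v divr_ge0.
have c0 : 0 <= cos v by apply: cos_ge0_pihalf; rewrite /v; apply/andP; split; lra.
have c2 : 1 / 2 <= cos v ^+ 2.
  have : 0 <= cos t by apply: cos_ge0_pihalf; apply/andP; split; lra.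
  have -> : t = v *+ 2 by rewrite /v -mulr_natr divfK.
  by rewrite cos_mulr2n -mulr_natr; lra.
have sv : v * cos v <= sin v.
  have [|x] := @MVT_segment _ (@sin R) (@cos R) 0 v v0.
    exact/continuous_subspaceT/continuous_sin.
  rewrite in_itv /= => /andP[x0 xv]; rewrite sin0 !subr0 => ->.
  rewrite mulrC ler_wpM2r //.
  have vp : v <= pi by rewrite /v; lra.
  by rewrite leNgt ltr_cos ?in_itv /= ?x0 ?v0 ?(le_trans xv) // -leNgt.
have -> : sin t = 2 * (cos v * sin v).
  have {1}-> : t = v *+ 2 by rewrite /v -mulr_natr divfK.
  by rewrite sin_mulr2n mulr_natl.
have : v * cos v ^+ 2 <= cos v * sin v.
  have -> : v * cos v ^+ 2 = cos v * (v * cos v) by ring.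
  exact: ler_wpM2l.
have : v * (1 / 2) <= v * cos v ^+ 2 by rewrite ler_wpM2l.
by rewrite /v; lra.
Qed.

Lemma sin2_ge t : `|t| <= pi / 2 -> t ^+ 2 / 4 <= sin t ^+ 2.
Proof.
wlog t0 : t / 0 <= t => [h|].
  have [|/ltW t0] := leP 0 t; first exact: h.
  by rewrite -normrN -sqrrN -[sin t ^+ 2]sqrrN -sinN; apply: h; rewrite oppr_ge0.
rewrite ger0_norm // => tp.
have -> : t ^+ 2 / 4 = (t / 2) ^+ 2 by field.
by rewrite lerXn2r ?nnegrE ?divr_ge0 ?sin_ge_half ?t0 // (le_trans _ (sin_ge_half _)) ?divr_ge0 ?t0.
Qed.
End Cis.

(** * Fourier transform of the weighted slack of the walk *)

Section Walk.
Variable R : realType.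

Lemma box_fourier n p (f g : 'I_n -> 'I_p -> R) :
  \sum_(a : {ffun 'I_n -> 'I_p})
     (\prod_i f i (a i))%:C%C * cis (\sum_i g i (a i)) =
  \prod_i \sum_b (f i b)%:C%C * cis (g i b).
Proof.
rewrite bigA_distr_bigA /=; apply: eq_bigr => a _.
by rewrite rmorph_prod cis_sum -big_split.
Qed.

Definition walk_weight M (b : 'I_(2 * M).+1) : R := 'C(2 * M, b)%:R.
Definition walk_step M (b : 'I_(2 * M).+1) : R := b%:R - M%:R.

(* Up to the factor [(4 ^+ M) ^+ n], the Fourier transform of the law of the walk
   times [6 M (\sum_i w i) - \sum_i w i * (step i) ^+ 2], in terms of [c = cos ^+ 2]. *)
Definition walk_hat n M (w c : 'I_n -> R) : R :=
  (6 * M%:R - M%:R ^+ 2) * (\sum_i w i) * \prod_l c l ^+ M +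
  M%:R * (2 * M%:R - 1) / 2 *
    \sum_i w i * \prod_l c l ^+ (M - (l == i)).

Lemma walk_sum M t : \sum_b (walk_weight b)%:C%C * cis (@walk_step M b * (t * 2)) =
  (4 ^+ M * (cos t ^+ 2) ^+ M)%:C%C.
Proof.
rewrite binomial_cis exprMn !exprM; congr (_ %:C)%C; congr (_ ^+ _ * _).
by rewrite expr2; lra.
Qed.

Lemma walk_sum_moment M t : (0 < M)%N ->
  \sum_b (walk_weight b * (M%:R ^+ 2 - walk_step b ^+ 2))%:C%C *
     cis (@walk_step M b * (t * 2)) =
  (4 ^+ M * (cos t ^+ 2) ^+ (M - 1) * (M%:R * (2 * M%:R - 1) / 2))%:C%C.
Proof.
move=> M0; rewrite binomial_cis_moment //; congr (_ %:C)%C.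
have -> : (2 * M - 2 = 2 * (M - 1))%N by lia.
have -> : ((2 * M).-1 = 2 * M - 1)%N by lia.
rewrite exprMn !exprM -exprMn.
rewrite natrM natrB ?natrM; last by lia.
case: M M0 => // M _; rewrite subn1 /= exprS exprMn.
have -> : 2 * 2 ^+ 1 = 4 :> R by rewrite expr1; lra.
rewrite [4 ^+ M.+1]exprS; move: (4 ^+ M : R) ((cos t ^+ 2) ^+ M) (M.+1%:R : R) => x y m; by field.
Qed.

Lemma walk_fourier n M (w th : 'I_n -> R) : (0 < M)%N ->
  \sum_(a : {ffun 'I_n -> 'I_(2 * M).+1})
    ((\prod_i walk_weight (a i)) *
     (6 * M%:R * (\sum_i w i) - \sum_i w i * walk_step (a i) ^+ 2))%:C%C *
    cis (\sum_i walk_step (a i) * (th i * 2)) =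
  ((4 ^+ M) ^+ n * walk_hat M w (fun i => cos (th i) ^+ 2))%:C%C.
Proof.
move=> M0; move EW: (\sum_i w i) => W.
pose F (i l : 'I_n) (b : 'I_(2 * M).+1) : R :=
  walk_weight b * (if l == i then M%:R ^+ 2 - walk_step b ^+ 2 else 1).
have FE i (a : {ffun 'I_n -> 'I_(2 * M).+1}) :
    \prod_l F i l (a l) = (\prod_l walk_weight (a l)) * (M%:R ^+ 2 - walk_step (a i) ^+ 2).
  rewrite big_split /=; congr (_ * _).
  by rewrite -big_mkcond big_pred1_eq.
transitivity (
  ((6 * M%:R - M%:R ^+ 2) * W)%:C%C *
   (\sum_(a : {ffun 'I_n -> 'I_(2 * M).+1}) (\prod_i walk_weight (a i))%:C%C *
      cis (\sum_i walk_step (a i) * (th i * 2))) +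
   \sum_i (w i)%:C%C * \sum_(a : {ffun 'I_n -> 'I_(2 * M).+1})
     (\prod_l F i l (a l))%:C%C * cis (\sum_i walk_step (a i) * (th i * 2))).
  rewrite mulr_sumr.
  under [X in _ = _ + X]eq_bigr do rewrite mulr_sumr.
  rewrite exchange_big -big_split /=; apply: eq_bigr => a _.
  under [X in _ = _ + X]eq_bigr do rewrite mulrA -rmorphM /=.
  rewrite -mulr_suml mulrA -mulrDl -(rmorphM (real_complex R)) -(rmorph_sum (real_complex R)) -(rmorphD (real_complex R)) /=.
  congr (_ %:C%C * _).
  under [X in _ = _ + X]eq_bigr do rewrite FE mulrCA mulrBr.
  rewrite -mulr_sumr sumrB -mulr_suml EW; ring.
rewrite (box_fourier (fun _ b => walk_weight b) (fun i b => walk_step b * (th i * 2))).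
under eq_bigr do rewrite walk_sum.
under [X in _ + X]eq_bigr do rewrite (box_fourier (F _) (fun i b => walk_step b * (th i * 2))).
rewrite -rmorph_prod -rmorphM /=.
have h i : \prod_l \sum_b (F i l b)%:C%C * cis (walk_step b * (th l * 2)) =
   ((4 ^+ M) ^+ n * (M%:R * (2 * M%:R - 1) / 2) *
      \prod_l (cos (th l) ^+ 2) ^+ (M - (l == i)))%:C%C.
  transitivity (\prod_l (4 ^+ M * (cos (th l) ^+ 2) ^+ (M - (l == i)) *
      (if l == i then (M%:R * (2 * M%:R - 1) / 2) else 1))%:C%C : R[i]).
    apply: eq_bigr => l _; rewrite /F; case: eqP => _ /=.
      by rewrite walk_sum_moment.
    under eq_bigr do rewrite mulr1.
    by rewrite walk_sum subn0 mulr1.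
  rewrite -rmorph_prod /= !big_split /= -big_mkcond big_pred1_eq.
  by rewrite prodr_const card_ord; congr (_ %:C%C); ring.
under [X in _ + X]eq_bigr do rewrite h -rmorphM /=.
rewrite -rmorph_sum -rmorphD /=; congr (_ %:C%C).
rewrite big_split /= prodr_const card_ord /walk_hat EW.
under [X in _ + X]eq_bigr do rewrite mulrCA.
rewrite -mulr_sumr; ring.
Qed.

(** Isolates the value at frequency zero. As 6M - M^2 + M (2M - 1) / 2 = 11/2 M, the quadratic terms
    cancel, and what is left of order M^2 carries factors [1 - c i], which vanish there. *)
Lemma walk_hatE n M (w c : 'I_n -> R) : (0 < M)%N ->
  walk_hat M w c = 11 / 2 * M%:R * (\sum_i w i) * \prod_l c l ^+ M +
  M%:R * (2 * M%:R - 1) / 2 *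
    \sum_i w i * (1 - c i) * \prod_l c l ^+ (M - (l == i)).
Proof.
move=> M0; rewrite /walk_hat.
have h i : \prod_l c l ^+ M = c i * \prod_l c l ^+ (M - (l == i)).
  rewrite (bigD1 i) //= [in RHS](bigD1 i) //= eqxx mulrA -exprS subn1 prednK //.
  by congr (_ * _); apply: eq_bigr => l /negPf ->; rewrite subn0.
have -> : \sum_i w i * \prod_l c l ^+ (M - (l == i)) =
   (\sum_i w i) * \prod_l c l ^+ M +
    \sum_i w i * (1 - c i) * \prod_l c l ^+ (M - (l == i)).
  rewrite mulr_suml -big_split /=; apply: eq_bigr => i _.
  rewrite (h i); ring.
by field.
Qed.

(** All exponents are at least M - 1 >= M / 2, so [c <= expR (- (1 - c))] bounds the products by
    [E ^+ 2]. One factor [E] is spent on [M * u * E <= 4], which lowers the order of the second term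
    from M^2 to M. The constant 10 covers 11/2 + 4. *)
Lemma walk_hat_bound n M (w c : 'I_n -> R) : (2 <= M)%N ->
  (forall i, 0 <= w i) -> (forall i, 0 <= c i <= 1) ->
  0 <= walk_hat M w c <= 10 * M%:R * (\sum_i w i) *
     expR (- (M%:R * (\sum_i (1 - c i)) / 4)).
Proof.
move=> M2 w0 c01; have M0 : (0 < M)%N by exact: ltn_trans M2.
rewrite walk_hatE //; set W := \sum_i w i; set u := \sum_i (1 - c i).
have M2R : 2 <= M%:R :> R by rewrite ler_nat.
have c0 i : 0 <= c i by case/andP: (c01 i).
have c1 i : c i <= 1 by case/andP: (c01 i).
have s0 i : 0 <= 1 - c i by rewrite subr_ge0.
have W0 : 0 <= W by exact: sumr_ge0.
have u0 : 0 <= u by exact: sumr_ge0.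
have su i : 1 - c i <= u.
  by rewrite /u (bigD1 i) //= lerDl sumr_ge0.
set E := expR (- (M%:R * u / 4)).
have PE (k : 'I_n -> nat) : (forall l, (M.-1 <= k l)%N) ->
    0 <= \prod_l c l ^+ k l <= E ^+ 2.
  move=> kM; apply/andP; split; first by apply: prodr_ge0 => l _; apply: exprn_ge0.
  rewrite /E -expRM_natl.
  apply: (@le_trans _ _ (\prod_l expR (- (1 - c l)) ^+ M.-1)).
    apply: ler_prod => l _; rewrite exprn_ge0 //=.
    apply: (@le_trans _ _ (c l ^+ M.-1)); first by rewrite ler_wiXn2l.
    rewrite lerXn2r ?nnegrE ?expR_ge0 // -[leLHS](_ : 1 + - (1 - c l) = _); last by lra.
    exact: expR_ge1Dx.
  rewrite prodrXl -expR_sum -expRM_natl ler_expR sumrN -/u.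
  have -> : M.-1%:R = M%:R - 1 :> R by rewrite -subn1 natrB.
  nra.
have E0 : 0 < E by exact: expR_gt0.
have E1 : E <= 1 by rewrite /E -expR0 ler_expR oppr_le0 divr_ge0 // mulr_ge0.
have /andP[P0 PE2] := PE (fun=> M) (fun=> leq_pred M).
have PiE i : 0 <= \prod_l c l ^+ (M - (l == i)) <= E ^+ 2.
  by apply: PE => l; case: (l == i); lia.
set P := \prod_l c l ^+ M in P0 PE2 *.
set S := \sum_i _ * _.
have S0 : 0 <= S.
  by apply: sumr_ge0 => i _; rewrite !mulr_ge0 //; case/andP: (PiE i).
have SE : S <= W * (u * E ^+ 2).
  rewrite /S mulr_suml; apply: ler_sum => i _; rewrite -mulrA ler_wpM2l //.
  by case/andP: (PiE i) => ? ?; rewrite ler_pM.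
have uE : M%:R * u * E <= 4.
  have := expR_ge1Dx (M%:R * u / 4).
  have EE : expR (M%:R * u / 4) * E = 1 by rewrite -expRD subrr expR0.
  move/(ler_wpM2r (ltW E0)); rewrite EE mulrDl mul1r => h.
  have : M%:R * u / 4 * E <= 1 by lra.
  by lra.
have A0 : 0 <= M%:R * (2 * M%:R - 1) / 2 :> R by rewrite divr_ge0 ?mulr_ge0 //; lra.
apply/andP; split.
  by apply: addr_ge0; [rewrite !mulr_ge0 //; lra | exact: mulr_ge0].
have h1 : 11 / 2 * M%:R * W * P <= 11 / 2 * M%:R * W * E.
  rewrite ler_wpM2l ?mulr_ge0 // (le_trans PE2) // expr2 ler_piMr // ltW //.
have h2 : M%:R * (2 * M%:R - 1) / 2 * S <= 4 * (M%:R * W * E).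
  apply: (@le_trans _ _ (M%:R ^+ 2 * (W * (u * E ^+ 2)))).
    by rewrite ler_pM // expr2; nra.
  have -> : M%:R ^+ 2 * (W * (u * E ^+ 2)) = (M%:R * u * E) * (M%:R * W * E) by ring.
  by rewrite ler_wpM2r // !mulr_ge0 // ltW.
have : 0 <= M%:R * W * E by rewrite !mulr_ge0 // ltW.
by lra.
Qed.

End Walk.

Lemma dvdz_sum (I : Type) (r : seq I) (F : I -> int) (d : int) :
  (forall i, (d %| F i)%Z) -> (d %| \sum_(i <- r) F i)%Z.
Proof. by move=> h; apply: rpred_sum => i _; exact: h. Qed.

(** * Characters of Z^n modulo an integral lattice *)

Section Characters.
Variables (R : realType) (n N' : nat).
Local Notation N := N'.+1.
Implicit Types (k : {ffun 'I_n -> 'I_N}) (x : 'rV[int]_n).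

Definition kdot k x : int := \sum_i (k i : nat)%:Z * x 0 i.

Definition root_angle (m : int) : R := m%:~R * (pi *+ 2 / N%:R).

Definition chi k x : R[i] := cis (root_angle (kdot k x)).

Lemma cis_root_mod m m' : (m = m' %[mod N%:Z])%Z ->
  cis (root_angle m) = cis (root_angle m').
Proof.
move=> e; rewrite (divz_eq m N%:Z) e [in RHS](divz_eq m' N%:Z) /root_angle.
have h (q r : int) : cis ((q * N%:Z + r)%:~R * (pi *+ 2 / N%:R)) = cis (r%:~R * (pi *+ 2 / N%:R) : R).
  rewrite intrD mulrDl cisD intrM -mulrA mulrC -pmulrn [N%:R * _]mulrC.
  by rewrite divfK ?pnatr_eq0 // cis2pi_int mulr1.
by rewrite !h.
Qed.

Lemma cis_root_eq1 m : cis (root_angle m) = 1 -> (N%:Z %| m)%Z.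
Proof.
move=> c1; apply/dvdz_mod0P.
have N0 : 0 < N%:R :> R by rewrite ltr0n.
have r0 : 0 <= (m %% N%:Z)%Z by rewrite modz_ge0.
have rN : (m %% N%:Z)%Z < N%:Z by rewrite ltz_pmod.
have p0 := @pi_gt0 R.
have P2 : 0 < pi *+ 2 :> R by rewrite pmulrn_lgt0.
suff /eqP : root_angle (m %% N%:Z)%Z = 0.
  rewrite mulf_eq0 intr_eq0 => /orP[/eqP //|].
  by rewrite mulf_eq0 invr_eq0 pnatr_eq0 orbF mulrn_eq0 /= gt_eqF.
apply: cis_eq1_eq0.
- apply: mulr_ge0; first by rewrite ler0z.
  by rewrite divr_ge0 ?(ltW N0) // mulrn_wge0 // ltW.
- rewrite /root_angle mulrA ltr_pdivrMr // mulrC (ltr_pM2l P2).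
  by rewrite pmulrn ltr_int.
- by rewrite (@cis_root_mod _ m) // modz_mod.
Qed.

Lemma kdotD k k0 x : (kdot (k + k0) x = kdot k x + kdot k0 x %[mod N%:Z])%Z.
Proof.
apply/eqP; rewrite eqz_mod_dvd /kdot -big_split -sumrB /=.
apply: dvdz_sum => i; rewrite ffunE /= -mulrDl -mulrBl dvdz_mulr //.
rewrite -eqz_mod_dvd modz_nat; apply/eqP.
by rewrite -PoszD !modz_nat modn_mod.
Qed.

Lemma chiD k k0 x : chi (k + k0) x = chi k x * chi k0 x.
Proof. by rewrite /chi (cis_root_mod (kdotD k k0 x)) /root_angle intrD mulrDl cisD. Qed.

Lemma kdot_xD k x y : kdot k (x + y) = kdot k x + kdot k y.
Proof.
by rewrite /kdot -big_split; apply: eq_bigr => i _; rewrite mxE mulrDr.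
Qed.

Lemma chi_xD k x y : chi k (x + y) = chi k x * chi k y.
Proof. by rewrite /chi kdot_xD /root_angle intrD mulrDl cisD. Qed.

Lemma kdot_mulmx k m (z : 'rV[int]_m) (D : 'M[int]_(m, n)) :
  kdot k (z *m D) = \sum_i z 0 i * kdot k (row i D).
Proof.
rewrite /kdot; under eq_bigr do rewrite mxE mulr_sumr.
rewrite exchange_big; apply: eq_bigr => i _ /=.
by rewrite mulr_sumr; apply: eq_bigr => j _; rewrite mxE mulrCA.
Qed.

(** When N is the index |det D|, it kills the quotient of Z^n by the row lattice of [D], so every
    character of the quotient is some [chi k] and this set is the dual group. *)
Definition annihilator (D : 'M[int]_n) : {set {ffun 'I_n -> 'I_N}} :=
  [set k | [forall i, (N%:Z %| kdot k (row i D))%Z]].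

Lemma annihilatorP D k :
  reflect (forall i, (N%:Z %| kdot k (row i D))%Z) (k \in annihilator D).
Proof. by rewrite inE; exact: forallP. Qed.

Lemma annihilator_addr D k k0 : k0 \in annihilator D ->
  (k + k0 \in annihilator D) = (k \in annihilator D).
Proof.
move=> /annihilatorP h0; rewrite !inE; apply: eq_forallb => i.
have -> : (N%:Z %| kdot (k + k0) (row i D))%Z =
    (N%:Z %| kdot k (row i D) + kdot k0 (row i D))%Z.
  by apply/dvdz_mod0P/dvdz_mod0P; rewrite kdotD.
by apply: rpredDr; exact: h0.
Qed.

Lemma chi_lattice D k (z : 'rV[int]_n) : k \in annihilator D -> chi k (z *m D) = 1.
Proof.
move=> /annihilatorP h; rewrite /chi (@cis_root_mod _ 0).
  by rewrite /root_angle mul0r cis0.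
rewrite mod0z; apply/dvdz_mod0P; rewrite kdot_mulmx.
by apply: dvdz_sum => i; rewrite dvdz_mull.
Qed.

(** The witness is a column of the adjugate. Every column annihilates the lattice, as [D *m \adj D]
    is scalar; if all of them paired with [x] to multiples of the determinant, Cramer's rule would
    put [x] in the lattice. *)
Lemma separating_character D x : `|\det D|%N = N -> (forall z, x != z *m D) ->
  exists2 k, k \in annihilator D & chi k x != 1.
Proof.
move=> dD xL.
have dN : (N%:Z %| \det D)%Z by rewrite dvdzE dD /=.
have [c hc] : exists c, ~~ (N%:Z %| (x *m \adj D) 0%R c)%Z.
  apply/existsP; rewrite -negb_forall; apply/negP => /forallP h.
  pose z : 'rV[int]_n := \row_c ((x *m \adj D) 0%R c %/ \det D)%Z.
  have /eqP[] := xL z.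
  have D0 : \det D != 0 by rewrite -absz_eq0 dD.
  have zE : \det D *: z = x *m \adj D.
    apply/rowP => i; rewrite [LHS]mxE [z _ _]mxE mulrC divzK //.
    by have := h i; rewrite !dvdzE dD.
  apply/rowP => i; apply: (mulfI D0).
  have := congr1 (fun u : 'rV_n => (u *m D) 0 i) zE.
  by rewrite -mulmxA mul_adj_mx mul_mx_scalar -scalemxAl !mxE => ->.
pose k : {ffun 'I_n -> 'I_N} := [ffun l => inord `|(\adj D l c %% N%:Z)%Z|].
have kE y : (kdot k y = (y *m \adj D) 0%R c %[mod N%:Z])%Z.
  apply/eqP; rewrite eqz_mod_dvd /kdot mxE -sumrB; apply: dvdz_sum => l.
  rewrite ffunE inordK; last first.
    by rewrite -ltz_nat gez0_abs ?modz_ge0 // ltz_pmod.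
  rewrite gez0_abs ?modz_ge0 // [y 0 l * _]mulrC -mulrBl dvdz_mulr //.
  by rewrite -eqz_mod_dvd modz_mod.
exists k.
  apply/annihilatorP => i; apply/dvdz_mod0P; rewrite kE.
  apply/dvdz_mod0P; rewrite -row_mul mul_mx_adj mxE mxE.
  by case: eqP => _; rewrite ?mulr1n ?mulr0n ?dvdz0.
apply/eqP => /cis_root_eq1 /dvdz_mod0P; rewrite kE => /dvdz_mod0P.
by apply/negP.
Qed.

Lemma chi_orthogonality D x : `|\det D|%N = N -> (forall z, x != z *m D) ->
  \sum_(k in annihilator D) chi k x = 0.
Proof.
move=> dD xL; have [k0 k0A k01] := separating_character dD xL.
set S := \sum_(k in _) _.
have : S = S * chi k0 x.
  rewrite {1}/S (reindex_inj (addIr k0)) /= mulr_suml.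
  by apply: eq_big => k; [exact: annihilator_addr | rewrite chiD].
move/eqP; rewrite -subr_eq0 -{1}[S]mulr1 -mulrBr mulf_eq0 => /orP[/eqP //|].
by rewrite subr_eq0 eq_sym (negPf k01).
Qed.

(** The residue of least absolute value: it keeps the angle within pi / 2, the range in which
    [sin2_ge] applies. *)
Definition centered (b : 'I_N) : int := if (2 * b <= N)%N then b%:Z else b%:Z - N%:Z.

Lemma centered_inj : injective centered.
Proof.
move=> b b' h; apply: val_inj; move: h; rewrite /centered /=.
by have := ltn_ord b; have := ltn_ord b'; do 2!case: ifP; lia.
Qed.

Lemma centered_mod b : (centered b = b %[mod N%:Z])%Z.
Proof.
rewrite /centered; case: ifP => // _; apply/eqP; rewrite eqz_mod_dvd.
by rewrite addrAC subrr add0r rpredN.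
Qed.

Lemma sin2_centered b :
  (pi * ((centered b)%:~R / N%:R)) ^+ 2 / 4 <= 1 - cos (pi * (b%:R / N%:R)) ^+ 2 :> R.
Proof.
have N0 : 0 < N%:R :> R by rewrite ltr0n.
have p0 := @pi_gt0 R.
rewrite -sin2cos2.
have -> : sin (pi * (b%:R / N%:R)) ^+ 2 = sin (pi * ((centered b)%:~R / N%:R)) ^+ 2 :> R.
  rewrite /centered; case: ifP => // _.
  rewrite intrB mulrBl mulrBr [N%:~R / _]divff ?gt_eqF // mulr1.
  by rewrite sinB cospi sinpi mulr0 subr0 mulrN1 sqrrN.
apply: sin2_ge; rewrite normrM gtr0_norm // ler_pM2l //.
rewrite normrM [`|N%:R^-1|]gtr0_norm ?invr_gt0 //.
have : `|centered b| * 2 <= N%:Z.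
  by rewrite /centered; have := ltn_ord b; case: ifP; lia.
by rewrite -(ler_int R) intrM intr_norm -pmulrn => h; rewrite ler_pdivrMr //; lra.
Qed.

End Characters.

(** * Fourier inversion on a coset and covering by integral lattices *)

Section WalkCover.
Variable R : realType.

Lemma Re_sum (I : Type) (r : seq I) (P : pred I) (F : I -> R[i]) :
  complex.Re (\sum_(i <- r | P i) F i) = \sum_(i <- r | P i) complex.Re (F i).
Proof. by apply: (big_morph (@complex.Re R)) => // -[a b] [c d]. Qed.

Lemma ReMr (z : R[i]) (x : R) : complex.Re (z * x%:C%C) = complex.Re z * x.
Proof. by case: z => a b /=; rewrite mulr0 subr0. Qed.

Lemma ReMl (z : R[i]) (x : R) : complex.Re (x%:C%C * z) = x * complex.Re z.
Proof. by rewrite mulrC ReMr mulrC. Qed.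

Section Inversion.
Variables (n N' M : nat) (D : 'M[int]_n) (tau : 'rV[int]_n) (w : 'I_n -> R).
Local Notation N := N'.+1.
Local Notation box := {ffun 'I_n -> 'I_(2 * M).+1}.
Local Notation H := (@annihilator n N' D).
Hypothesis dD : `|\det D|%N = N.
Hypothesis M0 : (0 < M)%N.
Let W := \sum_i w i.

Let jump (a : box) : 'rV[int]_n := \row_i ((a i : nat)%:Z - M%:Z).
Let slack (a : box) : R := 6 * M%:R * W - \sum_i w i * walk_step R (a i) ^+ 2.
Let freq (k : {ffun 'I_n -> 'I_N}) (i : 'I_n) : R := cos (pi * ((k i)%:R / N%:R)) ^+ 2.

(* Summing over the annihilator of the lattice restricts the walk to one coset, on
   which the weighted slack would have nonpositive total. *)
Lemma walk_inversion :
  (forall a, (exists z, tau + jump a = z *m D) -> slack a <= 0) ->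
  walk_hat M w (freq 0) <= \sum_(k in H | k != 0) `|walk_hat M w (freq k)|.
Proof.
move=> neg; pose g (a : box) : R := (\prod_i walk_weight R (a i)) * slack a.
have jumpE (k : {ffun 'I_n -> 'I_N}) (a : box) : chi R k (jump a) =
    cis (\sum_i walk_step R (a i) * (pi * ((k i)%:R / N%:R) * 2)).
  rewrite /chi /root_angle /kdot rmorph_sum mulr_suml; congr cis.
  apply: eq_bigr => i _; rewrite mxE rmorphM rmorphB /= /walk_step -!pmulrn.
  by rewrite -[pi *+ 2]mulr_natr; ring.
have sumE : \sum_a (g a)%:C%C * \sum_(k in H) chi R k (tau + jump a) =
   \sum_(k in H) chi R k tau * ((4 ^+ M) ^+ n * walk_hat M w (freq k))%:C%C.
  under eq_bigr do rewrite mulr_sumr.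
  rewrite exchange_big; apply: eq_bigr => k _ /=.
  rewrite -walk_fourier // mulr_sumr; apply: eq_bigr => a _.
  by rewrite chi_xD jumpE mulrCA.
have LE : complex.Re (\sum_a (g a)%:C%C * \sum_(k in H) chi R k (tau + jump a)) <= 0.
  rewrite Re_sum; apply: sumr_le0 => a _; rewrite ReMl.
  have [[z az]|naz] := pselect (exists z, tau + jump a = z *m D); last first.
    rewrite chi_orthogonality ?mulr0 // => z; apply/eqP => e.
    by apply: naz; exists z.
  have sa := neg a (ex_intro _ z az).
  rewrite (eq_bigr (fun=> 1)); last by move=> k kH; rewrite az chi_lattice.
  rewrite Re_sum sumr_const mulr_le0_ge0 //.
  by rewrite mulr_ge0_le0 // prodr_ge0.
move: LE; rewrite sumE Re_sum.
have K0 : 0 < (4 ^+ M) ^+ n :> R by rewrite !exprn_gt0.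
have H0 : 0 \in H.
  by apply/annihilatorP => i; rewrite /kdot big1 ?dvdz0 // => l _; rewrite ffunE mul0r.
under eq_bigr do rewrite ReMr.
have chi0 : complex.Re (@chi R n N' 0 tau) = 1.
  by rewrite /chi /root_angle /kdot big1 ?mul0r ?cis0 // => l _; rewrite ffunE mul0r.
rewrite (bigD1 (0 : {ffun 'I_n -> 'I_N})) //=; rewrite /= in chi0.
rewrite chi0 mul1r -lerBrDr sub0r => h.
rewrite -(ler_pM2l K0); apply: (le_trans h); rewrite -sumrN mulr_sumr.
apply: ler_sum => k _; rewrite (le_trans (ler_norm _)) // normrN !normrM.
rewrite [`|(4 ^+ M) ^+ n|]gtr0_norm // ler_piMl ?mulr_ge0 ?(ltW K0) //.
exact: cos_max.
Qed.

Lemma walk_cover : (2 <= M)%N -> (forall i, 0 < w i) -> (0 < n)%N ->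
  (forall s : seq 'rV[int]_n, uniq s -> 0 \notin s ->
    \sum_(q <- s) expR (- (M%:R * (pi ^+ 2 / 16) *
       sqn (intmx R q *m invmx (intmx R D)^T))) <= 1 / 2) ->
  exists z : 'rV[int]_n,
   \sum_i w i * ((z *m D - tau) 0 i)%:~R ^+ 2 < 6 * M%:R * W.
Proof.
move=> M2 w0 n0 sumE.
have W0 : 0 < W.
  rewrite /W (bigD1 (Ordinal n0)) //=.
  by rewrite ltr_pwDl // sumr_ge0 // => i _; rewrite ltW.
have [//|nz] := pselect (exists z : 'rV[int]_n,
   \sum_i w i * ((z *m D - tau) 0 i)%:~R ^+ 2 < 6 * M%:R * W).
have M_gt0 : 0 < M%:R :> R by rewrite ltr0n.
have N0 : 0 < N%:R :> R by rewrite ltr0n.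
have freq01 k i : 0 <= freq k i <= 1.
  by rewrite /freq sqr_ge0 /= -[leRHS](cos2Dsin2 (pi * ((k i)%:R / N%:R))) lerDl sqr_ge0.
have w_ge0 i : 0 <= w i by rewrite ltW.
have bnd k := walk_hat_bound M2 w_ge0 (freq01 k).
have : walk_hat M w (freq 0) <= \sum_(k in H | k != 0) `|walk_hat M w (freq k)|.
  apply: walk_inversion => a [z az]; rewrite leNgt; apply/negP => sa.
  apply: nz; exists z; move: sa; rewrite /slack subr_gt0; congr (_ < _).
  apply: eq_bigr => i _; rewrite -az addrC addKr mxE rmorphB /=.
  by rewrite /walk_step -!pmulrn.
have -> : walk_hat M w (freq 0) = 11 / 2 * M%:R * W.
  rewrite walk_hatE // -/W.
  have f0 i : freq 0 i = 1 by rewrite /freq ffunE mul0r mulr0 cos0 expr1n.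
  rewrite [X in _ * X + _]big1 => [|i _]; last by rewrite f0 expr1n.
  rewrite [X in _ + _ * X]big1 => [|i _]; last by rewrite f0 subrr mulr0 mul0r.
  by rewrite mulr1 mulr0 addr0.
pose c (k : {ffun 'I_n -> 'I_N}) : 'rV[int]_n := \row_i centered (k i).
(* The dual vector [N^-1 c k] in coordinates of the dual basis; the division is exact on the
   annihilator. Since [q] is injective there, the sum over characters is dominated by a sum over
   distinct nonzero dual vectors. *)
pose q k : 'rV[int]_n := \row_i ((c k *m D^T) 0%R i %/ N%:Z)%Z.
have qE k : k \in H -> intmx R (q k) *m invmx (intmx R D)^T = N%:R^-1 *: intmx R (c k).
  move=> /annihilatorP kH.
  have uD : (intmx R D)^T \in unitmx.
    by rewrite unitmx_tr unitmxE unitfE det_map_mx intr_eq0 -absz_eq0 dD.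
  apply: (can_inj (mulmxK uD)); rewrite mulmxKV // -scalemxAl matrix.map_trmx -map_mxM.
  apply/rowP => i; have key : (N%:Z %| (c k *m D^T) 0%R i)%Z.
    apply/dvdz_mod0P; rewrite -[RHS](dvdz_mod0P (kH i)) mxE.
    apply/eqP; rewrite eqz_mod_dvd /kdot -sumrB; apply: dvdz_sum => l.
    rewrite !mxE -mulrBl dvdz_mulr // -eqz_mod_dvd; apply/eqP; exact: centered_mod.
  rewrite [RHS]mxE [X in _ = _ * X]mxE [LHS]mxE [q k _ _]mxE -{2}(divzK key).
  by rewrite rmorphM /= -pmulrn mulrCA mulVf ?mulr1 ?gt_eqF.
have cinj : injective c.
  move=> k k' /rowP e; apply/ffunP => i; apply: centered_inj.
  by have := e i; rewrite !mxE.
have qinj : {in H &, injective q}.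
  move=> k k' kH k'H e; apply: cinj; have := qE k kH; rewrite e qE //.
  move=> h; apply/rowP => i; have := congr1 (fun u : 'rV_n => u 0 i) h.
  by rewrite !mxE => /(mulfI (invr_neq0 (lt0r_neq0 N0)))/intr_inj ->.
set s := [seq q k | k <- enum [set k in H | k != 0]].
have us : uniq s.
  rewrite map_inj_in_uniq ?enum_uniq // => k k'; rewrite !mem_enum !inE.
  by move=> /andP[kH _] /andP[k'H _]; apply: qinj; rewrite inE.
have H0 : 0 \in H.
  by apply/annihilatorP => i; rewrite /kdot big1 ?dvdz0 // => l _; rewrite ffunE mul0r.
have q0 : q 0 = 0.
  apply/rowP => i; rewrite mxE [RHS]mxE (_ : c 0 = 0) ?mul0mx ?mxE ?div0z //.
  by apply/rowP => l; rewrite !mxE ffunE.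
have s0 : 0 \notin s.
  apply/negP => /mapP[k]; rewrite mem_enum inE => /andP[kH k0] /esym e.
  by case/eqP: k0; apply: qinj => //; rewrite e q0.
have := sumE s us s0; rewrite big_map big_enum_cond /= => h1 h2.
suff : \sum_(k in H | k != 0) `|walk_hat M w (freq k)| <=
   10 * M%:R * W * (1 / 2).
  have : 0 < M%:R * W by rewrite mulr_gt0.
  by move=> h3 h4; lra.
have A0 : 0 <= 10 * M%:R * W by rewrite !mulr_ge0 // ltW.
apply: le_trans (ler_wpM2l A0 h1); rewrite mulr_sumr.
rewrite [leRHS](eq_bigl (fun k => (k \in H) && (k != 0))); last first.
  by move=> k; rewrite andbT [LHS]inE.
apply: ler_sum => k /andP[kH k0].
have /andP[b0 b1] := bnd k; rewrite ger0_norm // (le_trans b1) // ler_wpM2l //.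
rewrite ler_expR lerN2 qE // -[X in _ <= X]mulrA -[X in X <= _]mulrA ler_pM2l //.
rewrite /sqn mulr_suml mulr_sumr; apply: ler_sum => i _.
have := sin2_centered R (k i); rewrite -/(freq k i) !mxE [N%:R^-1 * _]mulrC exprMn.
by move: (_ / N%:R) => y; lra.
Qed.

End Inversion.
End WalkCover.

(** * The anisotropic covering bound *)

Section GaussianCover.
Variables (R : realType) (n : nat).
Implicit Types (w : 'I_n -> R) (x y : 'rV[R]_n).

Definition wsq w x : R := \sum_i w i * x 0 i ^+ 2.

Lemma sqn_wsq x : sqn x = wsq (fun=> 1) x.
Proof. by apply: eq_bigr => i _; rewrite mul1r. Qed.

Lemma wsq_ge0 w x : (forall i, 0 < w i) -> 0 <= wsq w x.
Proof. by move=> w0; apply: sumr_ge0 => i _; rewrite mulr_ge0 ?sqr_ge0 // ltW. Qed.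

Lemma wsqZ w a x : wsq w (a *: x) = a ^+ 2 * wsq w x.
Proof. by rewrite /wsq mulr_sumr; apply: eq_bigr => i _; rewrite mxE exprMn mulrCA. Qed.

Lemma wsqD_le w x y : (forall i, 0 < w i) ->
  wsq w (x + y) <= 2 * wsq w x + 2 * wsq w y.
Proof.
move=> w0; rewrite /wsq !mulr_sumr -big_split; apply: ler_sum => i _ /=.
have -> : 2 * (w i * x 0 i ^+ 2) + 2 * (w i * y 0 i ^+ 2) =
    w i * (2 * x 0 i ^+ 2 + 2 * y 0 i ^+ 2) by ring.
rewrite mxE ler_wpM2l ?(ltW (w0 i)) //.
by have := sqr_ge0 (x 0 i - y 0 i); nra.
Qed.

Lemma wsqD_ge w x y : (forall i, 0 < w i) ->
  wsq w x / 2 - wsq w y <= wsq w (x + y).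
Proof.
move=> w0; rewrite /wsq mulr_suml -sumrB; apply: ler_sum => i _ /=.
rewrite mxE -mulrA -mulrBr ler_wpM2l ?(ltW (w0 i)) //.
by have := sqr_ge0 (x 0 i + 2 * y 0 i); nra.
Qed.

(** A crude factor depending on [n] and [w] suffices, because [e] is chosen afterwards. *)
Lemma wsq_mulmx_small w (E : 'M[R]_n) (e : R) x : (forall i, 0 < w i) ->
  (forall i j, `|E i j| <= e) ->
  wsq w (x *m E) <= e ^+ 2 * (n%:R ^+ 2 * (\sum_i w i) * \sum_i (w i)^-1) * wsq w x.
Proof.
move=> w0 Ee; set v := \sum_i (w i)^-1; set X := wsq w x.
have X0 : 0 <= X by exact: wsq_ge0.
have v0 : 0 <= v by apply: sumr_ge0 => i _; rewrite invr_ge0 ltW.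
pose r := Num.sqrt (X * v).
have xr i : `|x 0 i| <= r.
  rewrite -sqrtr_sqr ler_wsqrtr //.
  have xX : w i * x 0 i ^+ 2 <= X.
    rewrite /X /wsq (bigD1 i) //= lerDl sumr_ge0 // => j _.
    by rewrite mulr_ge0 ?sqr_ge0 // ltW.
  have iv : (w i)^-1 <= v.
    by rewrite /v (bigD1 i) //= lerDl sumr_ge0 // => j _; rewrite invr_ge0 ltW.
  have -> : x 0 i ^+ 2 = (w i * x 0 i ^+ 2) * (w i)^-1.
    by rewrite mulrAC mulfV ?mul1r // gt_eqF.
  have w_ge0 := ltW (w0 i).
  by apply: ler_pM => //; rewrite ?invr_ge0 // mulr_ge0 ?sqr_ge0.
have -> : e ^+ 2 * (n%:R ^+ 2 * (\sum_i w i) * v) * X =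
    \sum_i w i * (n%:R * (r * e)) ^+ 2.
  rewrite -mulr_suml !exprMn sqr_sqrtr ?mulr_ge0 //; ring.
apply: ler_sum => j _; rewrite ler_wpM2l ?(ltW (w0 j)) // -real_normK ?num_real //.
have h : `|(x *m E) 0 j| <= n%:R * (r * e).
  rewrite mxE (le_trans (ler_norm_sum _ _ _)) //.
  rewrite -[n in n%:R]card_ord mulr_natl -sumr_const; apply: ler_sum => i _.
  by rewrite normrM ler_pM.
by rewrite lerXn2r ?nnegrE // (le_trans _ h).
Qed.

Lemma near_identity_bounds w (E : 'M[R]_n) (e : R) x :
  (forall i, 0 < w i) -> (forall i j, `|E i j| <= e) ->
  e ^+ 2 * (n%:R ^+ 2 * (\sum_i w i) * \sum_i (w i)^-1) <= 1 / 4 ->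
  wsq w x / 4 <= wsq w (x *m (1%:M + E)) <= 4 * wsq w x.
Proof.
move=> w0 Ee small; rewrite mulmxDr mulmx1.
have X0 := wsq_ge0 x w0.
have h : wsq w (x *m E) <= 1 / 4 * wsq w x.
  by apply: le_trans (wsq_mulmx_small x w0 Ee) _; rewrite ler_wpM2r.
have := wsqD_le x (x *m E) w0; have := wsqD_ge x (x *m E) w0.
by move=> h1 h2; apply/andP; split; lra.
Qed.

(* Replacing the lattice by an integral one, up to dilation and a small distortion,
   puts it on the grid where the walk lives. *)
Lemma integral_approximation (B : 'M[R]_n) (e s : R) : B \in unitmx -> 0 < e -> 0 < s ->
  exists (d : R) (D : 'M[int]_n) (E : 'M[R]_n),
   [/\ 0 < d, d <= s, forall i j, `|E i j| <= e & d *: intmx R D = B *m (1%:M + E)].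
Proof.
move=> uB e0 s0; pose b := \sum_i \sum_j `|invmx B i j|.
have b0 : 0 <= b by apply: sumr_ge0 => i _; apply: sumr_ge0.
have b1 : 0 < b + 1 by lra.
pose d := Num.min (e / (b + 1)) s.
have d0 : 0 < d by rewrite /d lt_min s0 divr_gt0.
have ds : d <= s by rewrite /d ge_min lexx orbT.
have db : b * d <= e.
  have : d <= e / (b + 1) by rewrite /d ge_min lexx.
  rewrite ler_pdivlMr //; nra.
pose D : 'M[int]_n := \matrix_(i, j) Num.floor (B i j / d).
pose F := d *: intmx R D - B.
have Fd i j : `|F i j| <= d.
  rewrite !mxE.
  have /andP[h1 h2] := floor_itv (B i j / d).
  have e1 : B i j = d * (B i j / d) by rewrite mulrCA mulfV ?mulr1 // gt_eqF.
  rewrite [X in _ - X]e1 -mulrBr normrM gtr0_norm // ler_piMr ?(ltW d0) //.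
  by rewrite ler_norml; apply/andP; split; rewrite ?intrD1 in h2 *; lra.
exists d, D, (invmx B *m F); split=> // [i j|]; last first.
  by rewrite mulmxDr mulmx1 mulKVmx // /F addrC subrK.
rewrite mxE (le_trans (ler_norm_sum _ _ _)) // (le_trans _ db) //.
rewrite /b mulr_suml [leRHS](bigD1 i) //= ler_wpDr //.
  by apply: sumr_ge0 => l _; rewrite mulr_ge0 ?sumr_ge0 // ltW.
by rewrite mulr_suml; apply: ler_sum => l _; rewrite normrM ler_wpM2l.
Qed.

Lemma gaussian_cover (B : 'M[R]_n) (s : R) w : (0 < n)%N -> B \in unitmx -> 0 < s ->
  (forall i, 0 < w i) ->
  (forall S : seq 'rV[int]_n, uniq S -> 0 \notin S ->
     \sum_(q <- S) expR (- (pi * s ^+ 2 * sqn (intmx R q *m invmx B^T))) <= 1 / 2) ->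
  forall t : 'rV[R]_n, exists z : 'rV[int]_n,
    wsq w (intmx R z *m B - t) <= 1904 * s ^+ 2 * \sum_i w i.
Proof.
move=> n0 uB s0 w0 sumB t.
set W := \sum_i w i.
(* [kw] governs the distortion of the weighted form on the lattice, [k1] that of the Euclidean norm
   on the dual; [e] is then small enough for both. *)
pose kw := n%:R ^+ 2 * W * \sum_i (w i)^-1.
pose k1 := n%:R ^+ 2 * (\sum_(i < n) 1) * \sum_(i < n) (1 : R)^-1.
have W0 : 0 <= W by apply: sumr_ge0 => i _; exact: ltW.
have kw0 : 0 <= kw.
  by rewrite !mulr_ge0 // sumr_ge0 // => i _; rewrite invr_ge0 ltW.
have k10 : 0 <= k1 by rewrite !mulr_ge0 // sumr_ge0.
pose e := (2 * (kw + k1 + 1))^-1.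
have e0 : 0 < e by rewrite invr_gt0; lra.
have ek : e ^+ 2 * (kw + k1 + 1) <= 1 / 4.
  have h : e * (kw + k1 + 1) = 1 / 2.
    by rewrite /e invfM -mulrA mulVf ?mulr1 ?mul1r // gt_eqF //; lra.
  rewrite expr2 -mulrA h.
  have : e <= 1 / 2; last by lra.
  have := e0; nra.
have [d [D [E [d0 ds Ee dD]]]] := integral_approximation uB e0 s0.
have p2 := @pi_ge2 R; have p0 := @pi_gt0 R.
have e2 : 0 <= e ^+ 2 by exact: sqr_ge0.
have ekw : e ^+ 2 * kw <= 1 / 4 by nra.
have ek1 : e ^+ 2 * k1 <= 1 / 4 by nra.
have Ew x := near_identity_bounds x w0 Ee ekw.
have E1 x := @near_identity_bounds (fun=> 1) E e x (fun=> ltr01) Ee ek1.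
have Et (i j : 'I_n) : `|E^T i j| <= e by rewrite mxE.
have Et1 x := @near_identity_bounds (fun=> 1) E^T e x (fun=> ltr01) Et ek1.
have uE : 1%:M + E \in unitmx.
  rewrite -row_free_unit -kermx_eq0; apply/eqP/row_matrixP => i; rewrite row0.
  have /andP[h _] := E1 (row i (kermx (1%:M + E))).
  apply/eqP; rewrite -sqn_eq0 sqn_wsq eq_le wsq_ge0 // andbT.
  move: h; have -> : row i (kermx (1%:M + E)) *m (1%:M + E) = 0.
    by apply/sub_kermxP; exact: row_sub.
  rewrite [X in _ <= X](_ : _ = 0); first by lra.
  by rewrite /wsq big1 // => l _; rewrite mxE expr0n mulr0.
have d_neq0 : d != 0 by rewrite gt_eqF.
have pi_neq0 : pi != 0 :> R by rewrite gt_eqF.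
have DE : intmx R D = d^-1 *: (B *m (1%:M + E)) by rewrite -dD scalerA mulVf // scale1r.
have uD : intmx R D \in unitmx.
  by rewrite DE unitmxZ ?unitmx_mul ?uB // unitfE invr_eq0.
pose N' := `|\det D|%N.-1.
have detD : `|\det D|%N = N'.+1.
  rewrite prednK // absz_gt0 -(intr_eq0 R) -det_map_mx.
  by move: uD; rewrite unitmxE unitfE.
(* The walk lives on a grid of mesh [d], so its variance must be of order (s / d)^2. The choice
   makes x0 pi^2 / 16 equal to 4 pi s^2 / d^2, where the 4 absorbs the distortion of the dual. *)
pose x0 := 64 * s ^+ 2 / (pi * d ^+ 2).
have x00 : 0 <= x0 by rewrite divr_ge0 ?mulr_ge0 ?sqr_ge0 // ltW.
(* The added 2 secures both [x0 <= M] and the requirement [2 <= M] of [walk_cover]. *)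
pose M := (Num.truncn x0).+2.
have Mx : x0 <= M%:R.
  have := truncnS_gt x0; rewrite /M -[X in _ <= X%:R]addn1 natrD; lra.
have xM : M%:R <= x0 + 2.
  have : (Num.truncn x0)%:R <= x0 by rewrite truncn_le.
  have -> : M%:R = (Num.truncn x0)%:R + 2 :> R by rewrite /M -[_.+2]addn2 natrD.
  lra.
pose u := d^-1 *: (t *m (1%:M + E)).
pose tau : 'rV[int]_n := \row_i Num.floor (u 0 i).
have [|] := @walk_cover R n N' M D tau w detD isT isT w0 n0.
  move=> S uS S0; apply: le_trans (sumB S uS S0); apply: ler_sum => q _.
  rewrite ler_expR lerN2; pose p := intmx R q *m invmx (intmx R D)^T; rewrite -/p.
  have uDt : (intmx R D)^T \in unitmx by rewrite unitmx_tr.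
  have -> : intmx R q *m invmx B^T = d^-1 *: (p *m (1%:M + E^T)).
    apply: (can_inj (mulmxK (_ : B^T \in unitmx))); first by rewrite unitmx_tr.
    rewrite mulmxKV ?unitmx_tr // -scalemxAl -mulmxA.
    have -> : (1%:M + E^T) *m B^T = (B *m (1%:M + E))^T.
      by rewrite trmx_mul linearD /= trmx1.
    by rewrite scalemxAr -linearZ /= -DE /p mulmxKV.
  rewrite sqn_wsq wsqZ sqn_wsq.
  have /andP[_ h] := Et1 p.
  have P0 : 0 <= wsq (fun=> 1) p by apply: wsq_ge0.
  set P := wsq _ p in h P0 *; set Q := wsq _ _ in h *.
  have c0 : 0 <= pi * s ^+ 2 * d^-1 ^+ 2.
    by apply: mulr_ge0; [apply: mulr_ge0; [exact: ltW | exact: sqr_ge0] | exact: sqr_ge0].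
  apply: (@le_trans _ _ (pi * s ^+ 2 * d^-1 ^+ 2 * (4 * P))).
    by rewrite mulrA ler_wpM2l.
  have -> : pi * s ^+ 2 * d^-1 ^+ 2 * (4 * P) = x0 * (pi ^+ 2 / 16) * P.
    by rewrite /x0; move: (@pi R) pi_neq0 => c c_neq0; field; rewrite ?d_neq0 ?c_neq0.
  by rewrite ler_wpM2r // ler_wpM2r // divr_ge0 ?sqr_ge0.
move=> z hz; exists z.
set x := intmx R z *m B - t.
have xE : d^-1 *: (x *m (1%:M + E)) = intmx R (z *m D - tau) + (intmx R tau - u).
  rewrite /x mulmxBl scalerBr -/u -mulmxA scalemxAr -DE -map_mxM map_mxB.
  by rewrite addrA subrK.
have /andP[h1 _] := Ew x.
have h2 : wsq w (x *m (1%:M + E)) = d ^+ 2 * wsq w (d^-1 *: (x *m (1%:M + E))).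
  by rewrite wsqZ mulrA -exprMn mulfV // expr1n mul1r.
(* 14 = 2 * 6 + 2: twice the bound of the walk, plus twice the error of rounding the target to the
   grid. *)
have h3 : wsq w (d^-1 *: (x *m (1%:M + E))) <= 14 * M%:R * W.
  rewrite xE (le_trans (wsqD_le _ _ w0)) //.
  have a1 : wsq w (intmx R (z *m D - tau)) <= 6 * M%:R * W.
    by rewrite ltW //; apply: le_lt_trans hz; apply: ler_sum => i _; rewrite [X in _ * X ^+ 2]mxE.
  have a2 : wsq w (intmx R tau - u) <= W.
    apply: ler_sum => i _; rewrite ler_piMr ?(ltW (w0 i)) // !mxE.
    have := floor_itv (u 0 i); rewrite !mxE intrD1 => /andP[f1 f2].
    rewrite -real_normK ?num_real // expr_le1 // ler_norml; apply/andP; split; lra.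
  have M1 : 1 <= M%:R :> R by rewrite ler1n.
  have : W <= M%:R * W by rewrite ler_peMl.
  by lra.
have d2 : d ^+ 2 <= s ^+ 2 by rewrite lerXn2r ?nnegrE // ltW.
have d20 : 0 < d ^+ 2 by rewrite exprn_gt0.
(* 34 = 32 + 2, by [2 <= pi] and [d <= s]. With the distortion 4 of the weighted form, 4 * 14 * 34 =
   1904. *)
have Md : d ^+ 2 * M%:R <= 34 * s ^+ 2.
  have e1 : d ^+ 2 * x0 = 64 * s ^+ 2 / pi.
    by rewrite /x0; move: (@pi R) pi_neq0 => c c_neq0; field; rewrite ?d_neq0 ?c_neq0.
  have e3 : 64 * s ^+ 2 / pi <= 32 * s ^+ 2.
    by rewrite ler_pdivrMr //; have := sqr_ge0 s; nra.
  have : d ^+ 2 * M%:R <= d ^+ 2 * (x0 + 2) by rewrite ler_wpM2l ?(ltW d20).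
  by lra.
have h4 : d ^+ 2 * wsq w (d^-1 *: (x *m (1%:M + E))) <= d ^+ 2 * (14 * M%:R * W).
  by rewrite ler_wpM2l ?(ltW d20).
have h5 : d ^+ 2 * M%:R * W <= 34 * s ^+ 2 * W by rewrite ler_wpM2r.
by lra.
Qed.

End GaussianCover.

(** * Theta series of separated sets *)

Section Packing.
Variables (R : realType) (n : nat).
Implicit Types (x y : 'rV[R]_n) (X : set 'rV[R]_n).

Lemma norm2_sqr x : norm2 x ^+ 2 = sqn x.
Proof.
have dE : dot x x = sqn x by apply: eq_bigr => i _; rewrite expr2.
by rewrite /norm2 dE sqr_sqrtr // sqn_ge0.
Qed.

Definition separated (l : R) X := forall x y, X x -> X y -> x != y -> l <= sqn (x - y).

(* A separated set has at most one point in each cell of a grid of side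
   [Num.sqrt l / n], so its theta series is below the n-th power of a geometric one. *)
Definition packing_bound (v : R) : R := (2 / (1 - expR (- v))) ^+ n.

Lemma geometric_le (r : R) K : 0 <= r -> r < 1 -> \sum_(m < K) r ^+ m <= 1 / (1 - r).
Proof.
move=> r0 r1; rewrite ler_pdivlMr ?subr_gt0 // mulrC.
have h := subrX1 r K; set S := \sum_(m < K) _ in h *.
have -> : (1 - r) * S = - ((r - 1) * S) by ring.
by rewrite -h opprB lerBlDr lerDl exprn_ge0.
Qed.

(** Folds both half-lines so that the index of the cell of [t] is at most |t| on either side. The
    sign is recorded separately and accounts for the 2 in [packing_bound]. *)
Definition cell_index (j : int) : nat := match j with Posz m => m | Negz m => m end.

Lemma cell_index_inj (j j' : int) :
  (0 <= j) = (0 <= j') -> cell_index j = cell_index j' -> j = j'.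
Proof. by case: j => m; case: j' => m' //= _ ->. Qed.

Lemma cell_index_le (t : R) : (cell_index (Num.floor t))%:R ^+ 2 <= t ^+ 2.
Proof.
have := floor_itv t; case: (Num.floor t) => m /=.
  by rewrite -pmulrn => /andP[h _]; rewrite lerXn2r ?nnegrE // (le_trans _ h).
rewrite NegzE => /andP[_]; rewrite -addn1 PoszD opprD subrK intrN -pmulrn => h.
rewrite -[t ^+ 2]sqrrN lerXn2r ?nnegrE // ?oppr_ge0; last by lra.
by rewrite (le_trans (ltW h)) // oppr_le0.
Qed.

Lemma packing_sum (l u : R) X (s : seq 'rV[R]_n) : (0 < n)%N -> 0 < l -> 0 < u ->
  separated l X -> uniq s -> [set` s] `<=` X ->
  \sum_(x <- s) expR (- (u * sqn x)) <= packing_bound (u * l / n%:R ^+ 2).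
Proof.
move=> n0 l0 u0 sepX us sX.
have nR : 1 <= n%:R :> R by rewrite ler1n.
have nR0 : 0 < n%:R :> R by rewrite ltr0n.
(* With this side, two points of one cell are at squared distance below n a^2 = l / n <= l. *)
pose a := Num.sqrt l / n%:R.
have a0 : 0 < a by rewrite divr_gt0 ?sqrtr_gt0.
have a2 : a ^+ 2 = l / n%:R ^+ 2 by rewrite /a exprMn sqr_sqrtr ?ltW // exprVn.
pose j x i := Num.floor (x 0 i / a).
pose K := (\max_(x <- s) \max_(i < n) cell_index (j x i)).+1.
pose code x : {ffun 'I_n -> bool * 'I_K} :=
  [ffun i => (0 <= j x i, inord (cell_index (j x i)))].
have ltK x i : x \in s -> (cell_index (j x i) < K)%N.
  move=> xs; rewrite ltnS.
  rewrite (big_rem x xs) /=; apply: leq_trans (leq_maxl _ _).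
  by rewrite (bigD1 i) //= leq_maxl.
have code_inj : {in s &, injective code}.
  move=> x y xs ys /ffunP e; apply/eqP/negPn/negP => xy.
  have jE i : j x i = j y i.
    have := e i; rewrite !ffunE => -[e1 /(congr1 val)].
    by rewrite /= !inordK ?ltK // => e2; apply: cell_index_inj.
  have := sepX x y (sX _ xs) (sX _ ys) xy; apply/negP; rewrite -ltNge.
  have d i : (x - y) 0 i ^+ 2 < a ^+ 2.
    have /andP[h1 h2] := floor_itv (x 0 i / a).
    have /andP[h3 h4] := floor_itv (y 0 i / a).
    rewrite -/(j x i) jE in h1 h2; rewrite -/(j y i) in h3 h4.
    rewrite intrD1 in h2 h4.
    rewrite !mxE -real_normK ?num_real // ltrXn2r ?nnegrE ?(ltW a0) //.
    have -> : x 0 i - y 0 i = (x 0 i / a - y 0 i / a) * a.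
      by rewrite mulrBl !divfK ?gt_eqF.
    rewrite normrM [`|a|]gtr0_norm // gtr_pMl // ltr_norml; apply/andP; split; lra.
  apply: (@lt_le_trans _ _ (\sum_(i < n) a ^+ 2)).
    rewrite /sqn; apply: ltr_sum => //.
    by apply/hasP; exists (Ordinal n0); rewrite ?mem_index_enum.
  have -> : \sum_(i < n) a ^+ 2 = l / n%:R.
    rewrite sumr_const card_ord a2 -[LHS]mulr_natr; move: (n%:R : R) (gt_eqF nR0) => m m0.
    by field; rewrite m0.
  by rewrite ler_pdivrMr // ler_peMr ?(ltW l0).
pose v := u * l / n%:R ^+ 2.
have v0 : 0 < v by rewrite divr_gt0 ?mulr_gt0 ?exprn_gt0.
pose h (c : bool * 'I_K) : R := expR (- v) ^+ c.2.
have h0 c : 0 <= h c by rewrite exprn_ge0 ?expR_ge0.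
apply: (@le_trans _ _ (\sum_(x <- s) \prod_i h (code x i))).
  rewrite big_seq [leRHS]big_seq; apply: ler_sum => x xs.
  have -> : expR (- (u * sqn x)) = \prod_i expR (- (u * x 0 i ^+ 2)).
    by rewrite -expR_sum sumrN /sqn mulr_sumr.
  apply: ler_prod => i _; rewrite expR_ge0 /= /h ffunE /= inordK ?ltK //.
  rewrite -expRM_natl ler_expR mulrN lerN2.
  have hi := cell_index_le (x 0 i / a); rewrite -/(j x i) exprMn exprVn ler_pdivlMr ?exprn_gt0 // a2 in hi.
  (* Replacing m^2 by m in the exponent turns the Gaussian sum into a geometric series. *)
  have mm : (cell_index (j x i))%:R <= (cell_index (j x i))%:R ^+ 2 :> R.
    by rewrite -natrX ler_nat; case: (cell_index _) => // m; rewrite -mulnn leq_pmulr.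
  apply: (@le_trans _ _ ((cell_index (j x i))%:R ^+ 2 * v)).
    by rewrite ler_wpM2r ?(ltW v0).
  by rewrite /v -[u * l / _]mulrA mulrCA ler_wpM2l ?(ltW u0).
rewrite -(big_map code predT (fun c : {ffun 'I_n -> bool * 'I_K} => \prod_i h (c i))).
rewrite big_uniq /=; last by rewrite map_inj_in_uniq.
apply: (@le_trans _ _ (\sum_(c : {ffun 'I_n -> bool * 'I_K}) \prod_i h (c i))).
  rewrite [leRHS](bigID (mem [seq code x | x <- s])) /= lerDl sumr_ge0 // => c _.
  exact: prodr_ge0.
rewrite -(bigA_distr_bigA (fun _ => h)) /= prodr_const card_ord.
rewrite lerXn2r ?nnegrE ?sumr_ge0 ?divr_ge0 ?subr_ge0 ?expR_le1 ?oppr_le0 ?(ltW v0) //.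
rewrite -(pair_bigA _ (fun (b : bool) (m : 'I_K) => h (b, m))) /= big_bool /= /h /=.
have e1 : expR (- v) < 1 by rewrite expR_lt1 oppr_lt0.
have := geometric_le K (expR_ge0 (- v)) e1; rewrite mulrDl !mul1r.
by move=> hg; rewrite lerD.
Qed.

Lemma esum_le_seq X (f : 'rV[R]_n -> R) (b : R) :
  (forall s, uniq s -> [set` s] `<=` X -> \sum_(x <- s) f x <= b) ->
  (\esum_(y in X) (f y)%:E <= b%:E)%E.
Proof.
move=> h; apply: ge_ereal_sup => /= _ [A [finA AX] <-].
rewrite fsbig_finite // sumEFin lee_fin; apply: h => [|x /=]; first exact: finmap.fset_uniq.
by rewrite in_fset_set // inE => /AX.
Qed.

Lemma esum_ge_seq X (f : 'rV[R]_n -> R) s : uniq s -> [set` s] `<=` X ->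
  ((\sum_(x <- s) f x)%:E <= \esum_(y in X) (f y)%:E)%E.
Proof.
move=> us sX; apply: esum_ge; exists [set` s]; first by split=> //; exact: finite_seq.
by rewrite -fsbig_seq // sumEFin.
Qed.

Definition theta X (u : R) : R := fine (\esum_(y in X) (expR (- (u * sqn y)))%:E).

(** * Continuity, tail and level 3/2 of a theta series *)

Section Theta.
Variables (X : set 'rV[R]_n) (l : R).
Hypotheses (n0 : (0 < n)%N) (l0 : 0 < l) (sepX : separated l X) (X0 : X 0).

Lemma thetaE u : 0 < u ->
  \esum_(y in X) (expR (- (u * sqn y)))%:E = (theta X u)%:E.
Proof.
move=> u0; rewrite fineK // ge0_fin_numE; last first.
  by apply: esum_ge0 => y _; rewrite lee_fin expR_ge0.
apply: (@le_lt_trans _ _ (packing_bound (u * l / n%:R ^+ 2))%:E); last exact: ltry.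
by apply: esum_le_seq => s us sX; apply: (packing_sum n0 l0 u0 sepX).
Qed.

Lemma theta_le u b : 0 < u ->
  (forall s, uniq s -> [set` s] `<=` X -> \sum_(y <- s) expR (- (u * sqn y)) <= b) ->
  theta X u <= b.
Proof. by move=> u0 h; rewrite -lee_fin -thetaE //; exact: esum_le_seq. Qed.

Lemma theta_ge u s : 0 < u -> uniq s -> [set` s] `<=` X ->
  \sum_(y <- s) expR (- (u * sqn y)) <= theta X u.
Proof. by move=> u0 us sX; rewrite -lee_fin -thetaE //; exact: esum_ge_seq. Qed.

Lemma theta_ge0 u : 0 < u -> 0 <= theta X u.
Proof.
move=> u0; have := @theta_ge u [::] u0 isT; rewrite big_nil; apply.
by move=> x /=; rewrite in_nil.
Qed.

Lemma theta_anti u u' : 0 < u' -> u' <= u -> theta X u <= theta X u'.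
Proof.
move=> u0 uu; apply: theta_le => [|s us sX]; first exact: lt_le_trans uu.
apply: le_trans (theta_ge u0 us sX); apply: ler_sum => y _.
by rewrite ler_expR lerN2 ler_wpM2r ?sqn_ge0.
Qed.

(** Termwise the difference is at most (u - u') q exp(-u' q). Half of the exponent absorbs q,
    through q exp(-u' q / 2) <= 2 / u', and the other half remains summable. This local Lipschitz
    bound provides continuity. *)
Lemma theta_lipschitz u u' : 0 < u' -> u' <= u ->
  theta X u' <= theta X u + (u - u') * (2 / u' * theta X (u' / 2)).
Proof.
move=> u0 uu; have u20 : 0 < u' / 2 by rewrite divr_gt0.
have du : 0 <= u - u' by rewrite subr_ge0.
apply: theta_le => // s us sX.
apply: (@le_trans _ _ (\sum_(y <- s) expR (- (u * sqn y)) +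
   (u - u') * (2 / u' * \sum_(y <- s) expR (- (u' / 2 * sqn y))))); last first.
  rewrite lerD ?theta_ge ?(lt_le_trans u0) // ler_wpM2l // ler_wpM2l ?divr_ge0 ?(ltW u0) //.
  exact: theta_ge.
rewrite !mulr_sumr -big_split; apply: ler_sum => y _ /=.
set q := sqn y; have q0 : 0 <= q := sqn_ge0 y.
set e := expR (- (u' / 2 * q)).
have e0 : 0 < e := expR_gt0 _.
have ee : expR (- (u' * q)) = e * e by rewrite -expRD; congr expR; field.
have -> : expR (- (u * q)) = e * e * expR (- ((u - u') * q)).
  by rewrite -ee -expRD; congr expR; ring.
have h1 := expR_ge1Dx (- ((u - u') * q)).
have qe : u' / 2 * q * e <= 1.
  have := expR_ge1Dx (u' / 2 * q).
  have E1 : expR (u' / 2 * q) * e = 1 by rewrite -expRD subrr expR0.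
  by move/(ler_wpM2r (ltW e0)); rewrite E1 mulrDl; lra.
have e2q : q * e <= 2 / u'.
  by rewrite ler_pdivlMr //; lra.
rewrite ee; have h2 : e * e * (1 - (u - u') * q) <= e * e * expR (- ((u - u') * q)).
  by rewrite ler_wpM2l ?mulr_ge0 ?(ltW e0).
have h3 : (u - u') * (q * e * e) <= (u - u') * (2 / u' * e).
  by rewrite ler_wpM2l // ler_wpM2r ?(ltW e0).
by lra.
Qed.

(** Away from the origin u q is cut in half: one half is at least u l / 2, the other at least q / (2
    l), and the packing bound for the latter depends on [n] alone. *)
Lemma theta_tail u : 1 <= u * l ->
  theta X u <= 1 + expR (- (u * l / 2)) * packing_bound (1 / (2 * n%:R ^+ 2)).
Proof.
move=> ul1; have u0 : 0 < u by rewrite -(pmulr_lgt0 _ l0) (lt_le_trans ltr01).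
apply: theta_le => // s us sX.
pose s' := [seq y <- s | y != 0].
have us' : uniq s' by rewrite filter_uniq.
have s'X : [set` s'] `<=` X by move=> y /=; rewrite mem_filter => /andP[_ /sX].
have l2 : 0 < 1 / (2 * l) by rewrite divr_gt0 // mulr_gt0.
have nR : n%:R != 0 :> R by rewrite pnatr_eq0 -lt0n.
have := packing_sum n0 l0 l2 sepX us' s'X.
have -> : 1 / (2 * l) * l / n%:R ^+ 2 = 1 / (2 * n%:R ^+ 2).
  by move: (n%:R : R) nR (gt_eqF l0) => m m0 le0; field; rewrite m0 le0.
move=> hp; rewrite (bigID (pred1 0)) /=; apply: lerD.
  rewrite -big_filter; have : (size (seq.filter (pred1 (0%R : 'rV[R]_n)) s) <= 1)%N.
    by rewrite size_filter count_uniq_mem //; case: (_ \in _).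
  case: (seq.filter _ s) (filter_all (pred1 (0%R : 'rV[R]_n)) s) => [|y [|//]] /=.
    by rewrite big_nil.
  by rewrite andbT => /eqP -> _; rewrite big_seq1 -expR0 ler_expR oppr_le0 mulr_ge0 ?(ltW u0) ?sqn_ge0.
apply: le_trans (ler_wpM2l (expR_ge0 _) hp); rewrite -big_filter mulr_sumr.
rewrite big_seq [leRHS]big_seq; apply: ler_sum => y ys.
have ly : l <= sqn y.
  have := ys; rewrite mem_filter => /andP[y0 /sX Xy].
  by have := sepX Xy X0 y0; rewrite subr0.
rewrite -expRD ler_expR -opprD lerN2.
have : 1 / (2 * l) <= u / 2.
  by rewrite ler_pdivrMr ?mulr_gt0 //; lra.
have := sqn_ge0 y; move: (sqn y) ly => q lq q0 h.
have : 1 / (2 * l) * q <= u / 2 * q by rewrite ler_wpM2r.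
have : u * l <= u * q by rewrite ler_wpM2l ?(ltW u0).
by lra.
Qed.

(** Since u l exp(-u l / 2) <= 2, a value of u l above 4 G + 1 brings the tail below 1/2. That the
    threshold depends only on [n] is what makes [C_eta] finite. *)
Lemma theta_tail_lt u : 4 * packing_bound (1 / (2 * n%:R ^+ 2)) + 1 < u * l ->
  theta X u < 3 / 2.
Proof.
set G := packing_bound _ => h.
have G0 : 0 <= G.
  have v0 : 0 <= 1 / (2 * n%:R ^+ 2) :> R by rewrite divr_ge0 // mulr_ge0.
  by rewrite exprn_ge0 // divr_ge0 // subr_ge0 expR_le1 oppr_le0.
have ul1 : 1 <= u * l by lra.
apply: (le_lt_trans (theta_tail ul1)); rewrite -/G.
set e := expR _; have e0 : 0 < e := expR_gt0 _.
have ee : expR (u * l / 2) * e = 1 by rewrite -expRD subrr expR0.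
have := expR_ge1Dx (u * l / 2); move/(ler_wpM2r (ltW e0)); rewrite ee => h2.
have h3 : u * l * e <= 2 by lra.
have : (4 * G + 1) * e <= u * l * e by rewrite ler_wpM2r ?ltW.
by lra.
Qed.

Lemma theta_level : (exists2 y, X y & y != 0) -> exists2 u, 0 < u & theta X u = 3 / 2.
Proof.
move=> [y0 Xy y0n]; have q0 := sqn_gt0 y0n.
(* As exp(-1/2) >= 1/2, the origin and [y0] alone contribute 3/2 at this parameter. *)
pose a := 1 / (2 * sqn y0); have a0 : 0 < a by rewrite divr_gt0 ?mulr_gt0.
have ga : 3 / 2 <= theta X a.
  apply: (@le_trans _ _ (\sum_(y <- [:: 0; y0]) expR (- (a * sqn y)))).
    rewrite big_cons big_seq1 (_ : sqn (0 : 'rV_n) = 0); last by apply/eqP; rewrite sqn_eq0.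
    rewrite mulr0 oppr0 expR0; have := expR_ge1Dx (- (a * sqn y0)).
    have -> : a * sqn y0 = 1 / 2 by rewrite /a; field; rewrite gt_eqF.
    by lra.
  apply: theta_ge => //=; first by rewrite in_cons in_nil orbF eq_sym y0n.
  by move=> y /=; rewrite !inE => /orP[] /eqP ->.
pose b := (4 * packing_bound (1 / (2 * n%:R ^+ 2)) + 2) / l + a.
have gb u : b <= u -> theta X u < 3 / 2.
  move=> bu; apply: theta_tail_lt; rewrite -ltr_pdivrMr //.
  apply: lt_le_trans bu; rewrite /b; set G := packing_bound _.
  have : (4 * G + 1) / l < (4 * G + 2) / l by rewrite ltr_pM2r ?invr_gt0 //; lra.
  by lra.
have ab : a <= b.
  by rewrite leNgt; apply/negP => /ltW /gb; rewrite ltNge ga.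
pose K := 2 / a * theta X (a / 2).
have a20 : 0 < a / 2 by rewrite divr_gt0.
have K0 : 0 <= K by apply: mulr_ge0; [rewrite divr_ge0 ?(ltW a0) | exact: theta_ge0].
have lip u u' : a <= u' -> u' <= u -> theta X u' <= theta X u + (u - u') * K.
  move=> au uu; have u0 : 0 < u' := lt_le_trans a0 au.
  apply: le_trans (theta_lipschitz u0 uu) _; rewrite lerD2l ler_wpM2l ?subr_ge0 //.
  have u20 : 0 < u' / 2 by rewrite divr_gt0.
  rewrite ler_pM ?divr_ge0 ?theta_ge0 ?(ltW u0) //.
    by rewrite ler_wpM2l // lef_pV2 ?posrE.
  by apply: theta_anti => //; rewrite ler_wpM2r.
(* At the supremum of [A], a value above 3/2 would leave room to move right, and a value below would
   exclude nearby members of [A], both by the Lipschitz bound. *)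
pose A : set R := [set u | a <= u <= b /\ 3 / 2 <= theta X u].
have Aa : A a by split=> //; rewrite lexx.
have supA : has_sup A by split; [exists a | exists b => u [/andP[]]].
have Aub u : A u -> u <= sup A by move=> Au; apply: sup_upper_bound.
have sa := Aub _ Aa.
have sb : sup A <= b by apply: ge_sup; [exists a | move=> u [/andP[]]].
have s0 : 0 < sup A := lt_le_trans a0 sa.
exists (sup A) => //; apply/eqP; rewrite eq_le; apply/andP; split; rewrite leNgt; apply/negP => h.
  pose e := (theta X (sup A) - 3 / 2) / (K + 1).
  have e0 : 0 < e by rewrite divr_gt0; lra.
  have eK : e * K <= theta X (sup A) - 3 / 2.
    have : e * (K + 1) = theta X (sup A) - 3 / 2 by rewrite divfK // gt_eqF //; lra.
    by lra.
  have sb' : sup A < b.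
    rewrite lt_neqAle sb andbT; apply/eqP => E; have := gb b (lexx b).
    by rewrite -E; lra.
  pose t := Num.min b (sup A + e).
  have st : sup A < t by rewrite lt_min sb' /=; lra.
  have te : t <= sup A + e by rewrite ge_min lexx orbT.
  have At : A t.
    split; first by rewrite (le_trans sa (ltW st)) /= ge_min lexx.
    have := lip t (sup A) sa (ltW st).
    have : (t - sup A) * K <= e * K by rewrite ler_wpM2r //; lra.
    by lra.
  by have := Aub _ At; rewrite leNgt st.
pose e := (3 / 2 - theta X (sup A)) / (K + 1).
have e0 : 0 < e by rewrite divr_gt0; lra.
have eK : e * K < 3 / 2 - theta X (sup A).
  have : e * (K + 1) = 3 / 2 - theta X (sup A) by rewrite divfK // gt_eqF //; lra.
  by lra.
have [u Au su] := sup_adherent e0 supA.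
have us := Aub _ Au; have [/andP[au _] gu] := Au.
have := lip (sup A) u au us.
have : (sup A - u) * K <= e * K by rewrite ler_wpM2r //; lra.
by lra.
Qed.

End Theta.
End Packing.

(** * Dual lattices and lattice subspaces *)

Section Extrema.
Variable R : realType.

Lemma maximumE (A : set R) m : A m -> ubound A m -> maximum A = m.
Proof.
move=> Am um; rewrite /maximum; case: xgetP => [x _ [Ax ux]|/(_ m)[]//].
by apply/eqP; rewrite eq_le um // ux.
Qed.

Lemma minimumE (A : set R) m : A m -> lbound A m -> minimum A = m.
Proof.
move=> Am um; rewrite /minimum; case: xgetP => [x _ [Ax ux]|/(_ m)[]//].
by apply/eqP; rewrite eq_le um // ux.
Qed.

(** The hypothesis [0 <= m] covers the default value 0 of [minimum], so the bound applies whether or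
    not the minimum is attained. *)
Lemma minimum_le (A : set R) m : 0 <= m -> A m -> minimum A <= m.
Proof. by move=> m0 Am; rewrite /minimum; case: xgetP => // x _ [Ax]; apply. Qed.

End Extrema.

Section LatticeBasis.
Variables (R : realType) (n : nat).
Implicit Types (L : set 'rV[R]_n) (W : {vspace 'rV[R]_n}) (C : 'M[R]_n).

Lemma lattice_basis_det k k' (B : 'M[R]_(k, n)) (B' : 'M[R]_(k', n)) L :
  lattice_basis B L -> lattice_basis B' L -> \det (gram B) = \det (gram B').
Proof.
have transition p p' (A : 'M[R]_(p, n)) (A' : 'M[R]_(p', n)) :
    lattice_basis A L -> lattice_basis A' L ->
    exists Z : 'M[int]_(p, p'), A = intmx R Z *m A'.
  move=> [_ LA] [_ LA'].
  have /choice[z zP] (i : 'I_p) : exists z : 'rV[int]_p', row i A = intmx R z *m A'.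
    have : L (row i A).
      rewrite LA /=; exists (delta_mx 0 i); rewrite rowE; congr (_ *m _).
      by apply/rowP => j; rewrite !mxE; case: (_ && _).
    by rewrite LA'.
  exists (\matrix_i z i); apply/row_matrixP => i.
  by rewrite row_mul zP; congr (_ *m _); apply/rowP => j; rewrite !mxE.
move=> LB LB'; have [Z ZE] := transition _ _ _ _ LB LB'.
have [Z' Z'E] := transition _ _ _ _ LB' LB.
have fB := LB.1; have fB' := LB'.1.
have ekk : k = k'.
  apply/eqP; rewrite eqn_leq -{1}(eqP fB) -{2}(eqP fB').
  by apply/andP; split; [rewrite ZE | rewrite Z'E];
    exact: leq_trans (mxrankM_maxl _ _) (rank_leq_col _).
subst k'.
have : intmx R (Z *m Z') *m B = 1%:M *m B by rewrite map_mxM -mulmxA -Z'E -ZE mul1mx.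
move/(row_free_inj fB)/matrixP => e.
have ZZ' : Z *m Z' = 1%:M.
  apply/matrixP => i j; apply: (@intr_inj R); have := e i j; rewrite mxE => ->.
  by rewrite !mxE; case: eqP.
have [uZ _] := mulmx1_unit ZZ'.
by rewrite ZE det_gram_mul det_int_unit_sqr // mul1r.
Qed.

Lemma lattice_detE k (B : 'M[R]_(k, n)) L :
  lattice_basis B L -> lattice_det L = Num.sqrt (\det (gram B)).
Proof.
move=> LB; rewrite /lattice_det; case: xgetP => [d _ [k' [B' [LB' ->]]]|]; last first.
  by move/(_ (Num.sqrt (\det (gram B)))) => []; exists k, B.
by rewrite (lattice_basis_det LB LB').
Qed.

Lemma dotE (x y : 'rV[R]_n) : dot x y = (x *m y^T) 0 0.
Proof. by rewrite mxE; apply: eq_bigr => i _; rewrite mxE. Qed.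

Lemma full_lattice_unit (B : 'M[R]_n) L : lattice_basis B L -> B \in unitmx.
Proof. by case; rewrite row_free_unit. Qed.

Lemma linear_span_full (B : 'M[R]_n) L x : lattice_basis B L -> linear_span L x.
Proof.
move=> LB; have uB := full_lattice_unit LB; have [_ LE] := LB.
exists [seq row i B | i <- enum 'I_n]; split.
  move=> y /= /mapP[i _ ->]; rewrite LE /=; exists (delta_mx 0 i).
  by rewrite rowE; congr (_ *m _); apply/rowP => j; rewrite !mxE; case: (_ && _).
rewrite -(mulmxKV uB x) mulmx_sum_row; apply: memv_suml => i _.
by apply/memvZ/memv_span/map_f; rewrite mem_enum.
Qed.

Lemma int_matrix_of k m (A : 'M[R]_(k, m)) :
  (forall i j, A i j \is a Num.int) -> exists Z : 'M[int]_(k, m), A = intmx R Z.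
Proof.
move=> h; exists (\matrix_(i, j) Num.floor (A i j)).
by apply/matrixP => i j; rewrite !mxE floorK.
Qed.

Lemma dual_lattice_basis (B C : 'M[R]_n) L : lattice_basis B L -> C *m B^T = 1%:M ->
  lattice_basis C (dual_lattice L).
Proof.
move=> LB CB; have [uC uBt] := mulmx1_unit CB; have [_ LE] := LB.
split; first by rewrite row_free_unit.
apply/seteqP; split=> y /=.
  move=> [_ yL]; have [z zE] : exists z : 'rV[int]_n, y *m B^T = intmx R z.
    apply: int_matrix_of => i j; rewrite (ord1 i).
    have := yL (row j B); rewrite dotE.
    have -> : (y *m (row j B)^T) 0 0 = (y *m B^T) 0 j.
      by rewrite !mxE; apply: eq_bigr => l _; rewrite !mxE.
    apply; rewrite LE /=; exists (delta_mx 0 j).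
    by rewrite rowE; congr (_ *m _); apply/rowP => l; rewrite !mxE; case: (_ && _).
  by exists z; rewrite -zE -mulmxA (mulmx1C CB) mulmx1.
move=> [z ->]; split; first exact: (linear_span_full _ LB).
rewrite LE => _ [k ->]; rewrite dotE trmx_mul mulmxA -[_ *m C *m _]mulmxA CB mulmx1.
rewrite map_trmx -map_mxM mxE; exact: intr_int.
Qed.

Lemma mem_span_rows r (S : 'M[R]_(r, n)) x :
  reflect (exists w : 'rV_r, x = w *m S) (x \in <<[tuple row i S | i < r]>>%VS).
Proof.
apply: (iffP idP) => [xS|[w ->]]; last first.
  rewrite mulmx_sum_row; apply: memv_suml => i _; apply/memvZ/memv_span.
  by apply/tnthP; exists i; rewrite tnth_mktuple.
exists (\row_i coord [tuple row i S | i < r] i x).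
rewrite mulmx_sum_row {1}(coord_span xS); apply: eq_bigr => i _.
by rewrite mxE -tnth_nth tnth_mktuple.
Qed.

Lemma free_rows r (S : 'M[R]_(r, n)) :
  free [tuple row i S | i < r] = row_free S.
Proof.
apply/freeP/idP => [h|fS k].
  rewrite -kermx_eq0; apply/eqP/row_matrixP => i; rewrite row0.
  apply/rowP => j; rewrite [RHS]mxE; apply: (h (fun j => row i (kermx S) 0 j)).
  transitivity (row i (kermx S) *m S); last by apply/sub_kermxP; exact: row_sub.
  by rewrite mulmx_sum_row; apply: eq_bigr => l _; rewrite -tnth_nth tnth_mktuple.
move=> k0 i; have : (\row_i k i) *m S = 0 *m S.
  rewrite mul0mx -[RHS]k0 mulmx_sum_row; apply: eq_bigr => l _.
  by rewrite mxE -tnth_nth tnth_mktuple.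
by move/(row_free_inj fS)/rowP/(_ i); rewrite !mxE.
Qed.

Section FullLattice.
Variables (C : 'M[R]_n) (L : set 'rV[R]_n).
Hypothesis LC : lattice_basis C L.

Lemma full_latticeP x : L x <-> exists z : 'rV[int]_n, x = intmx R z *m C.
Proof. by rewrite LC.2. Qed.

(** The given basis of [W] may generate a proper sublattice of the intersection, so it is replaced
    by its saturation [K]. An integral right inverse [Z] of [K] shows that lattice points of [W]
    have integer coordinates. *)
Lemma lattice_subspace_basis W : lattice_subspace L W ->
  exists r (K : 'M[int]_(r, n)),
   [/\ row_free (intmx R K), \dim W = r &
       lattice_basis (intmx R K *m C) (L `&` [set` W])].
Proof.
move=> [s [sW sL]]; have uC := full_lattice_unit LC.
pose r := size s; pose S : 'M[R]_(r, n) := \matrix_(i < r) s`_i.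
have sE : s = [tuple row i S | i < r].
  apply: (@eq_from_nth _ 0); first by rewrite size_tuple.
  by move=> i ir; rewrite (nth_mktuple _ _ (Ordinal ir)) rowK.
have fS : row_free S by rewrite -free_rows -sE (basis_free sW).
have /choice[z zP] (i : 'I_r) : exists z : 'rV[int]_n, s`_i = intmx R z *m C.
  by apply/full_latticeP; apply: sL; rewrite /= mem_nth.
pose K0 : 'M[int]_(r, n) := \matrix_i z i.
have SE : S = intmx R K0 *m C.
  apply/row_matrixP => i; rewrite rowK zP row_mul; congr (_ *m _).
  by apply/rowP => j; rewrite !mxE.
have fK0 : row_free (intmx R K0) by move: fS; rewrite SE row_free_mul_unit.
have dW : \dim W = r by rewrite -(span_basis sW); apply/eqP; exact: (basis_free sW).
have rn := row_free_leq fK0; have en := subnKC rn.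
move: (n - r)%N en => e en.
have [K [T [Z [fK T0 KE KL]]]] : exists (K : 'M[int]_(r, n)) (T : 'M[int]_r) (Z : 'M[int]_(n, r)),
    [/\ row_free (intmx R K), \det T != 0, K0 = T *m K & K *m Z = 1%:M].
  move: K0 fK0 {SE}; case: _ / en => K0 fK0.
  have [P [T [uP T0 KE]]] := primitive_factor fK0.
  exists (usubmx P), T, (lsubmx (invmx P)); split=> //.
    by rewrite map_usubmx row_free_usubmx // intmx_unit.
  have := mulmxV uP; rewrite -{1}(vsubmxK P) -{1}(hsubmxK (invmx P)).
  by rewrite mul_col_row (scalar_mx_block _ _ 1) => /eq_block_mx[].
exists r, K; split=> //; split; first by rewrite row_free_mul_unit.
have uT : intmx R T \in unitmx by rewrite unitmxE unitfE det_map_mx intr_eq0.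
have memW x : reflect (exists w : 'rV_r, x = w *m (intmx R K *m C)) (x \in W).
  rewrite -(span_basis sW) {1}sE; apply: (iffP (mem_span_rows _ _)) => -[w ->].
    by exists (w *m intmx R T); rewrite SE KE map_mxM !mulmxA.
  exists (w *m invmx (intmx R T)).
  by rewrite SE KE map_mxM !mulmxA mulmxKV.
apply/seteqP; split=> x /=.
  move=> [/full_latticeP[k xk] /memW[w xw]]; exists (k *m Z).
  have : intmx R k = w *m intmx R K.
    by apply: (can_inj (mulmxK uC)); rewrite -xk xw mulmxA.
  by rewrite xw map_mxM => ->; rewrite -[w *m _ *m _]mulmxA -map_mxM KL map_mx1 mulmx1.
move=> [k ->]; split; last by apply/memW; exists (intmx R k).
by apply/full_latticeP; exists (k *m K); rewrite map_mxM mulmxA.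
Qed.

(** An inequality, since the intersection of [L] with the span may be finer than the lattice of the
    given rows; the index is the absolute value of [\det Z]. *)
Lemma int_matrix_subspace r (K : 'M[int]_(r, n)) : row_free (intmx R K) ->
  exists W, [/\ lattice_subspace L W, \dim W = r &
   lattice_det (L `&` [set` W]) <= Num.sqrt (\det (gram (intmx R K *m C)))].
Proof.
move=> fK; have uC := full_lattice_unit LC.
pose S := intmx R K *m C; have fS : row_free S by rewrite row_free_mul_unit.
pose W := <<[tuple row i S | i < r]>>%VS.
have fr : free [tuple row i S | i < r] by rewrite free_rows.
have dW : \dim W = r by rewrite (eqP fr) size_tuple.
have rowL i : L (row i S).
  by apply/full_latticeP; exists (row i K); rewrite row_mul map_row.
have LW : lattice_subspace L W.
  exists [tuple row i S | i < r]; split; first by rewrite basisEfree fr subvv dW size_tuple /=.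
  move=> y yS; have /tnthP[i ->] : y \in [tuple row i S | i < r] := yS.
  by rewrite tnth_mktuple.
exists W; split=> //.
have [r' [K' [fK' dW' LB]]] := lattice_subspace_basis LW.
rewrite dW in dW'; subst r'.
rewrite (lattice_detE LB) ler_wsqrtr //.
have /choice[z zP] (i : 'I_r) : exists z : 'rV[int]_r, row i S = intmx R z *m (intmx R K' *m C).
  have : (L `&` [set` W]) (row i S).
    by split=> //=; apply/memv_span/tnthP; exists i; rewrite tnth_mktuple.
  by rewrite LB.2.
pose Z : 'M[int]_r := \matrix_i z i.
have SE : S = intmx R Z *m (intmx R K' *m C).
  apply/row_matrixP => i; rewrite zP row_mul; congr (_ *m _).
  by apply/rowP => j; rewrite !mxE.
rewrite -/S SE det_gram_mul ler_peMl //.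
  by rewrite ltW // det_gram_gt0 // row_free_mul_unit.
have : row_free (intmx R Z) by move: fS; rewrite SE; exact: row_free_mull.
rewrite row_free_det det_map_mx intr_eq0 -rmorphXn /= ler1z => Z0.
by rewrite -gtz0_ge1 exprn_even_gt0.
Qed.

End FullLattice.
End LatticeBasis.

(** * Extremal quantities and constants *)

Section Maxima.
Variable R : realType.

Definition density (D : R) (r : nat) : R := Num.sqrt D `^ (- r%:R^-1).

Lemma density_gt0 D r : 0 < D -> 0 < density D r.
Proof. by move=> D0; rewrite powR_gt0 // sqrtr_gt0. Qed.

Lemma density_pow D r : 0 < D -> (0 < r)%N -> density D r ^+ (2 * r) * D = 1.
Proof.
move=> D0 r0; rewrite mulnC exprM.
have -> : density D r ^+ r = (Num.sqrt D)^-1.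
  rewrite /density -powR_mulrn ?powR_ge0 // -powRrM mulNr mulVf ?pnatr_eq0 -?lt0n //.
  by rewrite powR_inv1 // sqrtr_ge0.
by rewrite exprVn sqr_sqrtr ?(ltW D0) // mulVf // gt_eqF.
Qed.

Lemma density_anti D D' r : 0 < D -> D <= D' -> density D' r <= density D r.
Proof.
move=> D0 DD; have D'0 := lt_le_trans D0 DD.
case: r => [|r]; first by rewrite /density invr0 oppr0 !powRr0.
rewrite -(@ler_pXn2r _ (2 * r.+1)) ?nnegrE ?(ltW (density_gt0 _ _)) //.
rewrite -(ler_pM2r D'0) density_pow // -[X in X <= _](density_pow (r := r.+1) D0) //.
by rewrite ler_wpM2l // exprn_ge0 // ltW // density_gt0.
Qed.

Lemma density_le_iff D r a : 0 < D -> (0 < r)%N -> 0 <= a ->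
  (density D r <= a) = (1 <= a ^+ (2 * r) * D).
Proof.
move=> D0 r0 a0; rewrite -(density_pow D0 r0) ler_pM2r // ler_pXn2r ?nnegrE //.
  by rewrite muln_gt0.
exact: ltW (density_gt0 _ _).
Qed.

Variables (n : nat) (C : 'M[R]_n) (L : set 'rV[R]_n) (c : nat -> R).
Hypotheses (n0 : (0 < n)%N) (LC : lattice_basis C L) (c0 : forall r, (0 < r)%N -> 0 < c r).

Local Notation gdet K := (\det (gram (intmx R K *m C))).

Let gdet_gt0 r (K : 'M[int]_(r, n)) : row_free (intmx R K) -> 0 < gdet K.
Proof.
by move=> fK; rewrite det_gram_gt0 // row_free_mul_unit // (full_lattice_unit LC).
Qed.

(** The weight [c] serves both maxima: 1 for smoothing, the square root of the rank for covering.
    One least determinant per rank leaves n candidates. The subspace spanned by a minimizer attains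
    the same value, because its lattice cannot have smaller determinant. *)
Lemma weighted_density_max :
  exists m, [/\ exists r (K : 'M[int]_(r, n)),
       [/\ (0 < r)%N, row_free (intmx R K) & m = c r * density (gdet K) r],
     (forall r (K : 'M[int]_(r, n)), (0 < r)%N -> row_free (intmx R K) ->
       c r * density (gdet K) r <= m),
     (exists W, [/\ lattice_subspace L W, (1 <= \dim W <= n)%N &
       m = c (\dim W) * lattice_det (L `&` [set` W]) `^ (- (\dim W)%:R^-1)]) &
     (forall W, lattice_subspace L W -> (1 <= \dim W)%N ->
       c (\dim W) * lattice_det (L `&` [set` W]) `^ (- (\dim W)%:R^-1) <= m)].
Proof.
have uC := full_lattice_unit LC.
have /choice[d dP] (i : 'I_n) : exists di : R,
    (exists2 K : 'M[int]_(i.+1, n), row_free (intmx R K) & gdet K = di) /\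
    (forall K : 'M[int]_(i.+1, n), row_free (intmx R K) -> di <= gdet K).
  have lei : (i.+1 <= n)%N by [].
  have [K fK minK] := det_gram_min uC lei.
  by exists (gdet K); split; [exists K | exact: minK].
have d0 i : 0 < d i by have [[K fK <-] _] := dP i; exact: gdet_gt0.
pose v (i : 'I_n) := c i.+1 * density (d i) i.+1.
have [i _ maxi] := arg_maxP v (erefl true : xpredT (Ordinal n0)).
have bound r (K : 'M[int]_(r, n)) : (0 < r)%N -> row_free (intmx R K) ->
    c r * density (gdet K) r <= v i.
  case: r K => // r K _ fK; have rn : (r < n)%N := row_free_leq fK.
  have [j er] : exists j : 'I_n, r = j by exists (Ordinal rn).
  subst r; apply: le_trans (maxi j isT); rewrite /v ler_wpM2l ?(ltW (c0 _)) //.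
  by apply: density_anti => //; exact: (dP j).2.
have boundW W : lattice_subspace L W -> (1 <= \dim W)%N ->
    c (\dim W) * lattice_det (L `&` [set` W]) `^ (- (\dim W)%:R^-1) <= v i.
  move=> LW W1; have [r [K [fK dW LK]]] := lattice_subspace_basis LC LW.
  by rewrite (lattice_detE LK) dW; apply: bound => //; rewrite -dW.
exists (v i); split=> //.
  have [[K fK dK] _] := dP i; exists i.+1, K; split=> //.
  by rewrite /v dK.
have [[K fK dK] _] := dP i.
have [W [LW dW Wd]] := int_matrix_subspace LC fK.
exists W; split=> //; first by rewrite dW ltn_ord.
apply/eqP; rewrite eq_le boundW ?dW // andbT /v ler_wpM2l ?(ltW (c0 _)) //.
have [r [K' [fK' dW' LK]]] := lattice_subspace_basis LC LW.
rewrite dW in dW'; subst r.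
rewrite (lattice_detE LK) in Wd *.
apply: density_anti; first exact: gdet_gt0.
by move: Wd; rewrite ler_sqrt // dK // ltW.
Qed.

End Maxima.

(** * The smoothing parameter and the constant [C_eta] *)

Section Smoothing.
Variables (R : realType) (n : nat).
Hypothesis n0 : (0 < n)%N.
Implicit Types (B C : 'M[R]_n) (L : set 'rV[R]_n).

Lemma max_covering_ge B C L : lattice_basis B L -> C *m B^T = 1%:M ->
  forall r (K : 'M[int]_(r, n)), (0 < r)%N -> row_free (intmx R K) ->
    Num.sqrt r%:R * density (\det (gram (intmx R K *m C))) r <= max_covering L.
Proof.
move=> LB CB; have DC := dual_lattice_basis LB CB.
have c0 r : (0 < r)%N -> 0 < Num.sqrt r%:R :> R by rewrite sqrtr_gt0 ltr0n.
have [m [_ mK [W [LW dW mE]] mW]] := weighted_density_max n0 DC c0.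
rewrite /max_covering (@maximumE _ _ m) //; first by exists W.
by move=> _ [W' [LW' /andP[W1 _] ->]]; exact: mW.
Qed.

Lemma max_smoothing_spec B C L : lattice_basis B L -> C *m B^T = 1%:M ->
  [/\ 0 < max_smoothing L,
    (forall r (K : 'M[int]_(r, n)), row_free (intmx R K) ->
      1 <= max_smoothing L ^+ (2 * r) * \det (gram (intmx R K *m C))) &
    exists r (K : 'M[int]_(r, n)), [/\ (0 < r)%N, row_free (intmx R K) &
      max_smoothing L ^+ (2 * r) * \det (gram (intmx R K *m C)) = 1]].
Proof.
move=> LB CB; have DC := dual_lattice_basis LB CB.
have uC := full_lattice_unit DC.
have c0 r : (0 < r)%N -> 0 < 1 :> R by [].
have [m [[r [K [r0 fK mE]]] mK [W [LW /andP[W1 Wn] WE]] mW]] :=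
  weighted_density_max n0 DC (c := fun=> 1) c0.
have g0 r' (K' : 'M[int]_(r', n)) : row_free (intmx R K') ->
    0 < \det (gram (intmx R K' *m C)).
  by move=> fK'; rewrite det_gram_gt0 // row_free_mul_unit.
rewrite mul1r in mE.
have m0 : 0 < m by rewrite mE density_gt0 // g0.
have -> : max_smoothing L = m.
  apply: maximumE.
    by exists W; split=> //; [rewrite -dimv_eq0 -lt0n | rewrite WE mul1r].
  move=> _ [W' [LW' W'0 ->]]; rewrite -[leLHS]mul1r; apply: mW => //.
  by rewrite lt0n dimv_eq0.
split=> //; last by exists r, K; rewrite mE density_pow // g0.
move=> [|r'] K' fK'; first by rewrite muln0 expr0 det_mx00 mulr1.
by rewrite -density_le_iff ?g0 // ?(ltW m0) // -[leLHS]mul1r mK.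
Qed.

Lemma max_smoothing_le1 B C L : lattice_basis B L -> C *m B^T = 1%:M ->
  (forall r (K : 'M[int]_(r, n)), row_free (intmx R K) ->
     1 <= \det (gram (intmx R K *m C))) ->
  max_smoothing L <= 1.
Proof.
move=> LB CB h; have [a0 _ [r [K [r0 fK aE]]]] := max_smoothing_spec LB CB.
rewrite -(@ler_pXn2r _ (2 * r)) ?nnegrE ?(ltW a0) ?muln_gt0 // expr1n -[leRHS]aE.
by rewrite ler_peMr ?exprn_ge0 ?(ltW a0) // h.
Qed.

Lemma dual_lattice0 L : dual_lattice L 0.
Proof.
split; first by exists [::]; split=> [y|]; rewrite /= ?in_nil // mem0v.
by move=> x _; rewrite /dot big1 // => i _; rewrite mxE mul0r.
Qed.

(** A nonzero difference spans a sublattice of rank one, whose Gram determinant is its squared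
    length. *)
Lemma dual_lattice_separated B C L : lattice_basis B L -> C *m B^T = 1%:M ->
  separated (max_smoothing L ^- 2) (dual_lattice L).
Proof.
move=> LB CB; have [a0 aK _] := max_smoothing_spec LB CB.
have DC := dual_lattice_basis LB CB; have uC := full_lattice_unit DC.
move=> _ _ /(full_latticeP DC)[k ->] /(full_latticeP DC)[k' ->].
rewrite -mulmxBl -map_mxB; set q := k - k' => kk.
have q0 : intmx R q != 0.
  apply: contra kk => /eqP e; rewrite -subr_eq0 -mulmxBl -map_mxB -/q e.
  by rewrite mul0mx.
have fq : row_free (intmx R q) by rewrite /row_free rank_rV q0.
have := aK _ _ fq; rewrite det_mx11 -sqnE muln1 => h.
by rewrite -[_ ^- 2]mul1r ler_pdivrMr ?exprn_gt0 // mulrC.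
Qed.

Lemma dual_lattice_nonzero B C L : lattice_basis B L -> C *m B^T = 1%:M ->
  exists2 y, dual_lattice L y & y != 0.
Proof.
move=> LB CB; have DC := dual_lattice_basis LB CB; have uC := full_lattice_unit DC.
exists (row (Ordinal n0) C).
  apply/(full_latticeP DC); exists (delta_mx 0 (Ordinal n0)).
  by rewrite rowE; congr (_ *m _); apply/rowP => j; rewrite !mxE; case: (_ && _).
apply/eqP => e; have := mulmxV uC; move/(congr1 (row (Ordinal n0))).
rewrite row_mul e mul0mx => /rowP/(_ (Ordinal n0)).
by rewrite !mxE eqxx => /eqP; rewrite eq_sym oner_eq0.
Qed.

Lemma smoothing_parameterP B C L : lattice_basis B L -> C *m B^T = 1%:M ->
  0 < smoothing_parameter L /\
  theta (dual_lattice L) (pi * smoothing_parameter L ^+ 2) = 3 / 2.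
Proof.
move=> LB CB; have [a0 _ _] := max_smoothing_spec LB CB.
have l0 : 0 < max_smoothing L ^- 2 by rewrite invr_gt0 exprn_gt0.
have sep := dual_lattice_separated LB CB.
have pi0 := @pi_gt0 R.
have esumE s : 0 < s ->
    (\esum_(y in dual_lattice L) (expR (- pi * s ^+ 2 * norm2 y ^+ 2))%:E =
     (theta (dual_lattice L) (pi * s ^+ 2))%:E)%E.
  move=> s0; rewrite -(thetaE n0 l0 sep) ?mulr_gt0 ?exprn_gt0 //.
  by apply: eq_esum => y _; rewrite norm2_sqr !mulNr.
have [u u0 uE] := theta_level n0 l0 sep (dual_lattice0 L) (dual_lattice_nonzero LB CB).
rewrite /smoothing_parameter; case: xgetP => [s _ [s0]|]; last first.
  move/(_ (Num.sqrt (u / pi))) => [].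
  have s0 : 0 < Num.sqrt (u / pi) by rewrite sqrtr_gt0 divr_gt0.
  split=> //; rewrite esumE // sqr_sqrtr ?divr_ge0 ?(ltW u0) ?(ltW pi0) //.
  by rewrite mulrCA mulfV ?mulr1 ?uE // gt_eqF.
by rewrite esumE // => -[].
Qed.

Lemma smoothing_le_max : exists2 K : R, 0 < K & forall L, is_lattice n L ->
  smoothing_parameter L <= K * max_smoothing L.
Proof.
set t0 : R := 4 * packing_bound n (1 / (2 * n%:R ^+ 2)) + 1.
have t1 : 1 <= t0.
  have v0 : 0 <= 1 / (2 * n%:R ^+ 2) :> R by rewrite divr_ge0 // mulr_ge0.
  have : 0 <= packing_bound n (1 / (2 * n%:R ^+ 2) : R).
    by rewrite exprn_ge0 // divr_ge0 // subr_ge0 expR_le1 oppr_le0.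
  by rewrite /t0; lra.
exists t0 => [|L [B LB]]; first exact: lt_le_trans t1.
have CB : (invmx B)^T *m B^T = 1%:M.
  by rewrite -trmx_mul mulmxV ?trmx1 // (full_lattice_unit LB).
have [a0 _ _] := max_smoothing_spec LB CB.
have [s0 sE] := smoothing_parameterP LB CB.
set s := smoothing_parameter L in s0 sE *; set a := max_smoothing L in a0 *.
have l0 : 0 < a ^- 2 by rewrite invr_gt0 exprn_gt0.
have sep := dual_lattice_separated LB CB.
rewrite leNgt; apply/negP => h.
have : theta (dual_lattice L) (pi * s ^+ 2) < 3 / 2.
  apply: (theta_tail_lt n0 l0 sep (dual_lattice0 L)); rewrite -/t0.
  rewrite ltr_pdivlMr ?exprn_gt0 //.
  have h2 : (t0 * a) ^+ 2 < s ^+ 2 by rewrite ltrXn2r ?nnegrE ?mulr_ge0 ?(ltW a0) ?(ltW s0) // (le_trans _ t1).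
  have h3 : t0 * a ^+ 2 <= (t0 * a) ^+ 2.
    by rewrite exprMn ler_wpM2r ?sqr_ge0 // expr2 ler_peMl // (le_trans _ t1).
  have p2 := @pi_ge2 R.
  by have := sqr_ge0 s; nra.
by rewrite sE ltxx.
Qed.

(** Each defining inequality is closed in the constant, so the infimum satisfies all of them, and
    the one for Z^n makes it positive. Hence [minimum] does not fall back on its default. *)
Lemma C_etaP : 0 < C_eta R n /\ forall L, is_lattice n L ->
  smoothing_parameter L <= C_eta R n * max_smoothing L.
Proof.
pose S : set R := [set C : R | 0 < C /\ forall L : set 'rV[R]_n, is_lattice n L ->
                     smoothing_parameter L <= C * max_smoothing L].
have [K K0 KP] := smoothing_le_max.
have SK : S K by split.
have lat L : is_lattice n L -> 0 < smoothing_parameter L /\ 0 < max_smoothing L.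
  move=> [B LB]; have CB : (invmx B)^T *m B^T = 1%:M.
    by rewrite -trmx_mul mulmxV ?trmx1 // (full_lattice_unit LB).
  by have [a0 _ _] := max_smoothing_spec LB CB; have [s0 _] := smoothing_parameterP LB CB.
have infS : has_inf S by split; [exists K | exists 0 => x [/ltW]].
have le_inf L : is_lattice n L -> smoothing_parameter L <= inf S * max_smoothing L.
  move=> LL; have [s0 a0] := lat L LL.
  rewrite -ler_pdivrMr //; apply: lb_le_inf; first by exists K.
  by move=> x [x0 /(_ L LL)]; rewrite ler_pdivrMr.
have LZ : is_lattice n [set x : 'rV[R]_n | exists z : 'rV[int]_n, x = intmx R z *m 1%:M].
  by exists 1%:M; split=> //; rewrite row_free_unit unitmx1.
have inf0 : 0 < inf S.
  have [s0 a0] := lat _ LZ.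
  by rewrite -(pmulr_lgt0 _ a0) (lt_le_trans s0) // le_inf.
suff -> : C_eta R n = inf S by [].
apply: minimumE; first by split.
by move=> x Sx; apply: inf_lbound => //; exact: infS.2.
Qed.

End Smoothing.

(** * Harmonic sums *)

Section Harmonic.
Variable R : realType.

Lemma harmonic_le_ln n : (0 < n)%N ->
  \sum_(j < n) (j.+1%:R : R)^-1 <= 1 + ln n%:R.
Proof.
case: n => // n _; elim: n => [|n IH].
  by rewrite big_ord_recr big_ord0 /= add0r ln1 addr0 invr1.
rewrite big_ord_recr /=.
have n1 : 0 < n.+1%:R :> R by rewrite ltr0n.
have n2 : 0 < n.+2%:R :> R by rewrite ltr0n.
have : ln (1 + - (n.+2%:R : R)^-1) <= - n.+2%:R^-1.
  by apply: le_ln1Dx; rewrite ltrN2 invf_lt1 // ltr1n.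
have -> : 1 - (n.+2%:R : R)^-1 = n.+1%:R / n.+2%:R.
  by rewrite -(natr1 n.+1); move: (n.+1%:R) n1 => x x0; field; lra.
rewrite ln_div ?posrE // => h.
apply: le_trans (lerD IH (lexx _)) _.
by move: (ln _) (ln _) (_^-1) h => x y z; lra.
Qed.

(** The square becomes [ln n] once square roots are taken at the end. With x = ln n >= 1/2, both 1
    <= 4 x^2 and x <= 2 x^2, whence the 6. *)
Lemma harmonic_le_ln_sqr n : (2 <= n)%N ->
  \sum_(j < n) (j.+1%:R : R)^-1 <= 6 * ln n%:R ^+ 2.
Proof.
move=> n2; apply: le_trans (harmonic_le_ln (ltnW n2)) _.
have : 1 / 2 <= ln (n%:R : R).
  rewrite -ler_expR lnK ?posrE ?ltr0n ?(ltnW n2) //.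
  apply: (@le_trans _ _ 2); last by rewrite ler_nat.
  have := expR_ge1Dx (- (1 / 2) : R); have e0 := expR_gt0 (1 / 2 : R).
  have E : expR (1 / 2 : R) * expR (- (1 / 2)) = 1 by rewrite -expRD subrr expR0.
  by move/(ler_wpM2l (ltW e0)); rewrite E; lra.
by move: (ln _) => x; nra.
Qed.

End Harmonic.

(** * The bound on the covering radius *)

Section Main.
Variables (R : realType) (n : nat).
Hypothesis n2 : (2 <= n)%N.
Let n0 : (0 < n)%N := ltnW n2.

Lemma covering_radius_le (B : 'M[R]_n) L (r : R) : lattice_basis B L -> 0 < r ->
  (forall t, exists z : 'rV[int]_n, sqn (intmx R z *m B - t) <= r ^+ 2) ->
  covering_radius L <= r.
Proof.
move=> LB r0 h; apply: inf_lbound; first by exists 0 => x [].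
split; first exact: ltW.
move=> x _; have [z hz] := h x; exists (intmx R z *m B); first by rewrite LB.2 /=; exists z.
exists (r^-1 *: (x - intmx R z *m B)); last first.
  by rewrite scalerA mulfV ?gt_eqF // scale1r addrC subrK.
rewrite /closed_unit_ball2 /= -(@expr_le1 _ 2) ?sqrtr_ge0 // norm2_sqr.
have -> : sqn (r^-1 *: (x - intmx R z *m B)) = r ^- 2 * sqn (intmx R z *m B - x).
  rewrite !sqn_wsq wsqZ exprVn; congr (_ * _); rewrite -opprB.
  by apply: eq_bigr => i _; rewrite !mxE sqrrN.
by rewrite mulrC ler_pdivrMr ?exprn_gt0 // mul1r.
Qed.

(* [107 ^+ 2 >= 6 * 1904], the constants of [harmonic_le_ln_sqr] and of
   [gaussian_cover]. *)
Lemma covering_le_max (L : set 'rV[R]_n) : is_lattice n L ->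
  covering_radius L <= 107 * ln n%:R * C_eta R n * max_covering L.
Proof.
move=> [B LB]; have uB := full_lattice_unit LB.
pose C := (invmx B)^T.
have CB : C *m B^T = 1%:M by rewrite -trmx_mul mulmxV ?trmx1.
have uC : C \in unitmx by have [] := mulmx1_unit CB.
have [s0 sP] := C_etaP R n0; set s := C_eta R n in s0 sP *.
set M := max_covering L.
have [U [h [oU h0 st fl]]] := stable_scaling uC.
have uU := gram_unit oU; have uH := unit_diag h0.
(* The dual basis is stretched by [h] and the primal one shrunk by it, so the two stay dual to each
   other. *)
pose H := diag_mx h; pose C1 := C *m U *m H; pose B1 := B *m U *m invmx H.
have HT : H^T = H by rewrite /H tr_diag_mx.
have CB1 : C1 *m B1^T = 1%:M.
  rewrite /C1 /B1 !trmx_mul trmx_inv HT !mulmxA mulmxK //.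
  by rewrite -[C *m U *m U^T]mulmxA oU mulmx1.
have [uC1 uB1t] := mulmx1_unit CB1.
have uB1 : B1 \in unitmx by rewrite -unitmx_tr.
pose L1 := [set x | exists z : 'rV[int]_n, x = intmx R z *m B1].
have LB1 : lattice_basis B1 L1 by split; first rewrite row_free_unit.
have a1 : max_smoothing L1 <= 1 := max_smoothing_le1 n0 LB1 CB1 st.
have [e0 eE] := smoothing_parameterP n0 LB1 CB1.
have es : smoothing_parameter L1 <= s.
  apply: le_trans (sP L1 _) _; first by exists B1.
  by rewrite ler_piMr // ltW.
have [aa0 _ _] := max_smoothing_spec n0 LB1 CB1.
have l0 : 0 < max_smoothing L1 ^- 2 by rewrite invr_gt0 exprn_gt0.
have sep := dual_lattice_separated n0 LB1 CB1.
have pi0 := @pi_gt0 R.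
have DC1 := dual_lattice_basis LB1 CB1.
have thetas : theta (dual_lattice L1) (pi * s ^+ 2) <= 3 / 2.
  rewrite -eE; apply: (theta_anti n0 l0 sep); first by rewrite mulr_gt0 ?exprn_gt0.
  by rewrite ler_wpM2l ?(ltW pi0) // lerXn2r ?nnegrE ?(ltW e0) ?(ltW s0).
have w0 (i : 'I_n) : 0 < h 0 i ^+ 2 by rewrite exprn_gt0.
have invB1 : invmx B1^T = C1 by rewrite -[RHS]mulmx1 -(mulmxV uB1t) mulmxA CB1 mul1mx.
have gauss (S : seq 'rV[int]_n) : uniq S -> 0 \notin S ->
    \sum_(q <- S) expR (- (pi * s ^+ 2 * sqn (intmx R q *m invmx B1^T))) <= 1 / 2.
  move=> uS S0; rewrite invB1.
  pose f (q : 'rV[int]_n) := intmx R q *m C1.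
  have finj : injective f.
    move=> q q' /(can_inj (mulmxK uC1)) /matrixP e; apply/matrixP => i j.
    by apply: (@intr_inj R); have := e i j; rewrite !mxE.
  have f0 : f 0 = 0 by rewrite /f map_mx0 mul0mx.
  have us : uniq (map f (0 :: S)) by rewrite map_inj_uniq //= S0.
  have sD : [set` map f (0 :: S)] `<=` dual_lattice L1.
    move=> y yS; have /mapP[q _ ->] : y \in map f (0 :: S) := yS.
    by apply/(full_latticeP DC1); exists q.
  have ps : 0 < pi * s ^+ 2 by rewrite mulr_gt0 ?exprn_gt0.
  have := le_trans (theta_ge n0 l0 sep ps us sD) thetas.
  rewrite big_map big_cons f0 (_ : sqn (0 : 'rV_n) = 0); last by apply/eqP; rewrite sqn_eq0.
  by rewrite mulr0 oppr0 expR0 /f; lra.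
have cover := gaussian_cover n0 uB1 s0 w0 gauss.
set T := \sum_i h 0 i ^+ 2 in cover.
have MK := max_covering_ge n0 LB CB.
have hM (j : 'I_n) : h 0 j ^+ 2 <= M ^+ 2 * j.+1%:R^-1.
  have [D [K [jD fK hK]]] := fl j.
  have D0 : (0 < D)%N := leq_ltn_trans (leq0n _) jD.
  have g0 : 0 < \det (gram (intmx R K *m C)).
    by rewrite det_gram_gt0 // row_free_mul_unit.
  have := MK D K D0 fK; set x := density _ _ => xM.
  have x0 : 0 < x by rewrite density_gt0.
  have hx : h 0 j <= x.
    rewrite -(@ler_pXn2r _ (2 * D)) ?nnegrE ?(ltW (h0 j)) ?(ltW x0) ?muln_gt0 //.
    by rewrite -(ler_pM2r g0) density_pow.
  have h1 : h 0 j ^+ 2 <= x ^+ 2 by rewrite lerXn2r ?nnegrE ?(ltW (h0 j)) ?(ltW x0).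
  have h3 : D%:R * x ^+ 2 <= M ^+ 2.
    rewrite -[D%:R]sqr_sqrtr // -exprMn lerXn2r ?nnegrE ?mulr_ge0 ?sqrtr_ge0 ?(ltW x0) //.
    by apply: le_trans xM; rewrite mulr_ge0 ?sqrtr_ge0 ?(ltW x0).
  rewrite ler_pdivlMr ?ltr0n // (le_trans _ h3) // mulrC ler_pM ?sqr_ge0 //.
  by rewrite ler_nat.
have TM : T <= M ^+ 2 * (6 * ln n%:R ^+ 2).
  apply: le_trans (ler_wpM2l (sqr_ge0 M) (harmonic_le_ln_sqr R n2)).
  by rewrite mulr_sumr; apply: ler_sum => j _.
have ln0 : 0 < ln (n%:R : R) by rewrite ln_gt0 // ltr1n.
have M0 : 0 < M.
  have [D [K [jD fK _]]] := fl (Ordinal n0).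
  have D0 : (0 < D)%N := leq_ltn_trans (leq0n _) jD.
  apply: lt_le_trans (MK D K D0 fK); rewrite mulr_gt0 ?sqrtr_gt0 ?ltr0n //.
  by rewrite density_gt0 // det_gram_gt0 // row_free_mul_unit.
apply: (covering_radius_le LB); first by rewrite !mulr_gt0.
move=> t; have [z hz] := cover (t *m U *m invmx H); exists z.
have -> : sqn (intmx R z *m B - t) =
    wsq (fun i => h 0 i ^+ 2) (intmx R z *m B1 - t *m U *m invmx H).
  rewrite /B1 !mulmxA -mulmxBl -mulmxBl; set y := intmx R z *m B - t.
  transitivity (sqn (y *m U)).
    by rewrite !sqnE gram_rot.
  rewrite -[in LHS](mulmxKV uH (y *m U)); apply: eq_bigr => i _.
  by rewrite mul_mx_diag mxE exprMn mulrC.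
apply: (le_trans hz).
have s20 : 0 <= 1904 * s ^+ 2 by apply: mulr_ge0; [exact: ler0n | exact: sqr_ge0].
have := ler_wpM2l s20 TM; rewrite -/s -/M; generalize T M s (ln (n%:R : R)).
move=> x y v l h2; apply: (le_trans h2).
have := sqr_ge0 (l * v * y); rewrite !exprMn; set p := l ^+ 2 * _ * _ => p0.
have -> : 1904 * v ^+ 2 * (y ^+ 2 * (6 * l ^+ 2)) = 11424 * p by rewrite /p; ring.
have -> : 107 ^+ 2 * l ^+ 2 * v ^+ 2 * y ^+ 2 = 11449 * p by rewrite /p; ring.
by lra.
Qed.

Lemma C_KL_le : C_KL R n <= 107 * ln n%:R * C_eta R n.
Proof.
have [s0 _] := C_etaP R n0.
have ln0 : 0 < ln (n%:R : R) by rewrite ln_gt0 // ltr1n.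
have c0 : 0 < 107 * ln n%:R * C_eta R n by rewrite !mulr_gt0.
apply: minimum_le; first exact: ltW.
by split=> // L LL; exact: covering_le_max.
Qed.

End Main.

Theorem theorem4p2 (R : realType) :
  exists c : R, 0 < c /\
    forall n : nat, (2 <= n)%N -> C_KL R n <= c * ln n%:R * C_eta R n.
Proof. by exists 107; split=> // n; exact: C_KL_le. Qed.
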